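(* Let $d,Q\in\mathbb N$ with $Q\ge 2$, and let $\varphi:\mathbb T\to\mathbb R^d$ be a centered rational step function with denominator $Q$ and values $\Phi:\mathbb Z_Q\to\mathbb R^d$. Let $\Gamma:=\overline{\langle\varphi(\mathbb T)\rangle}$ be the closed subgroup of $\mathbb R^d$ generated by $\Phi(\mathbb Z_Q)$. Suppose that either (i) $\alpha\in\mathrm{SBAD}_Q$, or (ii) $\alpha\notin\mathbb Q$ and $Q$ is prime. Then $(\mathbb T\times\Gamma,\mathcal B(\mathbb T\times\Gamma),m_{\mathbb T}\times m_\Gamma,T_{\alpha,\varphi})$ is a conservative, ergodic, measure preserving transformation.
   Context: $\mathbb T:=\mathbb R/\mathbb Z\cong[0,1)$. $\mathbb Z_Q=\mathbb Z/Q\mathbb Z$ is identified with $\{0,1,\dots,Q-1\}$. The rational step function with denominator $Q$ and values $\Phi:\mathbb Z_Q\to\mathbb R^d$ is $\varphi:\mathbb T\to\mathbb R^d$, $\varphi(x):=\Phi(\lfloor Qx\rfloor)$ for $x\in[0,1)$. It is centered if $\int_{\mathbb T}\varphi(x)\,dx=0$, equivalently $\sum_{k\in\mathbb Z_Q}\Phi(k)=0$. The skew product is $T_{\alpha,\varphi}(x,y):=(x+\alpha,y+\varphi(x))$; it preserves $\mathbb T\times\Gamma$ and $m_{\mathbb T}\times m_\Gamma$. Here $m_{G}$ denotes Haar measure on the locally compact, Polish, Abelian group $G$ (normalized if $G$ is compact), and $\mathcal B$ denotes Borel sets. For irrational $\alpha$ (taken mod 1, in $(0,1)$) with regular continued fraction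 expansion $\alpha=\cfrac{1}{a_1+\cfrac{1}{a_2+\cdots}}$, the principal denominators are $q_0=1$, $q_1=a_1$, $q_{n+1}=a_{n+1}q_n+q_{n-1}$. For $Q\ge2$, $\mathrm{SBAD}_Q$ is the set of irrational $\alpha$ such that $\limsup_{n\to\infty}\frac{q_{n'}}{q_{n+1}}>0$, where $n':=\max\{1\le m<n:\ \frac{q_m}{q_n}<\frac1Q\}$ (defined for all large $n$). *)

(* Defs.v *)
From HB Require Import structures.
From mathcomp Require Import all_boot all_order all_algebra.
From mathcomp Require Import all_classical all_reals all_analysis.

Set Implicit Arguments.
Unset Strict Implicit.
Unset Printing Implicit Defensive.

Import Order.TTheory GRing.Theory Num.Theory.
Import numFieldNormedType.Exports.

Local Open Scope classical_set_scope.
Local Open Scope ring_scope.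

Definition frac (R : realType) (x : R) : R := x - (Num.floor x)%:~R.

Lemma frac_itv (R : realType) (x : R) : 0 <= frac x < 1.
Proof. by rewrite /frac subr_ge0 floor_le ltrBlDl -[X in _ + X](mulr1z 1) -intrD lt_succ_floor. Qed.

(** [R/Z], represented by its fundamental domain [0, 1). *)
Definition circle (R : realType) : Type := {x : R | 0 <= x < 1}.

Definition circle_val (R : realType) (x : circle R) : R := val x.

(** The projection [R -> R/Z]. *)
Definition circle_class (R : realType) (x : R) : circle R :=
  Sub (frac x) (frac_itv x).

HB.instance Definition _ (R : realType) := Choice.on (circle R).
HB.instance Definition _ (R : realType) :=
  isPointed.Build (circle R) (circle_class 0).

(** The Borel sets of [0, 1): the quotient topology of [R/Z] and the topology
    induced by [R] differ at the point 0 but have the same Borel sets. *)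
HB.instance Definition _ (R : realType) :=
  Measurable.copy (circle R)
    (g_sigma_algebra_preimageType (@circle_val R : _ -> measurableTypeR R)).

(** Normalized Haar measure of [R/Z]: Lebesgue measure on [0, 1). *)
Definition haar_circle (R : realType) (A : set (circle R)) : \bar R :=
  lebesgue_measure (@circle_val R @` A).

Definition rotation (R : realType) (alpha : R) (x : circle R) : circle R :=
  circle_class (circle_val x + alpha).

Section haar_circle_measure.
Variable R : realType.
Local Open Scope ereal_scope.

Let circle_valI : injective (@circle_val R).
Proof. exact: val_inj. Qed.

Let image_preimage (B : set R) :
  @circle_val R @` (@circle_val R @^-1` B) = B `&` `[0%R, 1%R[.
Proof.
apply/seteqP; split => [_ [x Bx <-]|x [Bx]].
  by split => //=; rewrite in_itv/=; exact: (valP x).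
by rewrite /= in_itv/= => x01; exists (Sub x x01).
Qed.

Lemma measurable_circle_val_image (A : set (circle R)) : measurable A ->
  measurable (@circle_val R @` A : set (measurableTypeR R)).
Proof.
by move=> [B mB]; rewrite setTI => <-; rewrite image_preimage; exact: measurableI.
Qed.

Let haar_circle0 : haar_circle (@set0 (circle R)) = 0.
Proof. by rewrite /haar_circle image_set0 measure0. Qed.

Let haar_circle_ge0 (A : set (circle R)) : 0 <= haar_circle A.
Proof. exact: measure_ge0. Qed.

Let haar_circle_sigma_additive : semi_sigma_additive (@haar_circle R).
Proof.
move=> F mF tF mUF; rewrite /haar_circle image_bigcup.
apply: measure_semi_sigma_additive.
- by move=> n; exact: measurable_circle_val_image.
- move=> i j _ _ [_ [[x Fix <-] [y Fjy /circle_valI yx]]].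
  by apply: tF => //; exists x; split=> //; rewrite -yx.
- by rewrite -image_bigcup; exact: measurable_circle_val_image.
Qed.

HB.instance Definition _ := isMeasure.Build _ _ _ (@haar_circle R)
  haar_circle0 haar_circle_ge0 haar_circle_sigma_additive.

Let haar_circle_setT : haar_circle [set: circle R] = 1.
Proof.
rewrite /haar_circle -[setT](preimage_setT (@circle_val R)) image_preimage.
by rewrite setTI lebesgue_measure_itv/= lte_fin ltr01 oppr0 adde0.
Qed.

HB.instance Definition _ :=
  Measure_isProbability.Build _ _ _ (@haar_circle R) haar_circle_setT.

End haar_circle_measure.

Definition is_subgroup (V : zmodType) (H : set V) : Prop :=
  H 0 /\ forall x y, H x -> H y -> H (x - y).

Definition closed_generated (V : topologicalZmodType) (S : set V) : set V :=
  closure (smallest (@is_subgroup V) S).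

Section closed_subgroup.
Variables (V : topologicalZmodType) (S : set V).

Let generated_subgroup : is_subgroup (smallest (@is_subgroup V) S).
Proof.
split=> [H [[H0 _] _]|x y Hx Hy H HS]; first exact: H0.
by have [[_ HB] _] := HS; apply: HB; [exact: Hx|exact: Hy].
Qed.

Lemma closed_generated_subgroup : is_subgroup (closed_generated S).
Proof.
split; first by apply: subset_closure; exact: generated_subgroup.1.
move=> x y clx cly B /(@sub_continuous V (x, y))[[P Q] /= [xP yQ]] PQB.
have [x' [Sx' Px']] := clx _ xP; have [y' [Sy' Qy']] := cly _ yQ.
exists (x' - y'); split; first exact: generated_subgroup.2.
exact: (PQB (x', y')).
Qed.

Lemma sub_closed_generated : S `<=` closed_generated S.
Proof. by move=> x Sx; apply: subset_closure; exact: sub_gen_smallest. Qed.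

Definition in_closed_generated : {pred V} := fun x => x \in closed_generated S.

Let in_closed_generated_zmod : zmod_closed in_closed_generated.
Proof.
have [S0 SB] := closed_generated_subgroup; split; first exact: mem_set.
by move=> x y /set_mem Sx /set_mem Sy; apply/mem_set; exact: SB.
Qed.

HB.instance Definition _ :=
  GRing.isZmodClosed.Build V in_closed_generated in_closed_generated_zmod.

Definition closed_subgroup : Type := {x : V | in_closed_generated x}.

Definition closed_subgroup_val (x : closed_subgroup) : V := val x.

HB.instance Definition _ := SubType.on closed_subgroup.
HB.instance Definition _ := Choice.on closed_subgroup.
HB.instance Definition _ := [SubChoice_isSubZmodule of closed_subgroup by <:].
HB.instance Definition _ :=
  Topological.copy closed_subgroup (initial_topology closed_subgroup_val).

Let closed_subgroup_sub_continuous :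
  continuous (fun x : closed_subgroup * closed_subgroup => x.1 - x.2).
Proof.
apply: continuous_comp_initial => x /=.
apply: (@continuous_comp _ _ _
  (fun x : closed_subgroup * closed_subgroup => (val x.1, val x.2))
  (fun x : V * V => x.1 - x.2)); last exact: sub_continuous.
apply: cvg_pair; apply: continuous_comp; [exact: cvg_fst| |exact: cvg_snd|];
  exact: initial_continuous.
Qed.

HB.instance Definition _ :=
  PreTopologicalNmodule_isTopologicalZmodule.Build closed_subgroup
    closed_subgroup_sub_continuous.

HB.instance Definition _ := isPointed.Build closed_subgroup 0.
HB.instance Definition _ :=
  Measurable.copy closed_subgroup
    (g_sigma_algebraType (@open closed_subgroup)).

End closed_subgroup.

(** [mu] is a Haar measure on the Borel sets of [G]; when [G] is compact it is
    the normalized one, otherwise it is determined up to a positive factor.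
    Regularity is automatic on the locally compact Polish groups considered. *)
Definition is_haar (R : realType) (G : topologicalZmodType)
    (mu : set G -> \bar R) : Prop :=
  [/\ forall (g : G) (A : set G), <<s @open G >> A ->
         mu [set g + x | x in A] = mu A,
      forall K : set G, compact K -> (mu K < +oo)%E,
      forall U : set G, open U -> U !=set0 -> (0 < mu U)%E &
      compact [set: G] -> mu [set: G] = 1%E].

Section dynamics.
Context (d : measure_display) (X : measurableType d) (R : realType).
Variables (mu : set X -> \bar R) (T : X -> X).

Definition measure_preserving : Prop :=
  measurable_fun [set: X] T /\
  forall A : set X, measurable A -> mu (T @^-1` A) = mu A.

Definition wandering (W : set X) : Prop :=
  trivIset [set: nat] (fun n => iter n T @^-1` W).

Definition conservative : Prop :=
  forall W : set X, measurable W -> wandering W -> mu W = 0%E.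

Definition ergodic : Prop :=
  forall A : set X, measurable A -> mu ((T @^-1` A) `+` A) = 0%E ->
    mu A = 0%E \/ mu (~` A) = 0%E.

End dynamics.

(** ['Z_Q] is [Z/QZ] only for [1 < Q]. *)
Definition step_function (R : realType) (d Q : nat) (Phi : 'Z_Q -> 'rV[R]_d)
    (x : circle R) : 'rV[R]_d :=
  Phi (Num.truncn (Q%:R * circle_val x))%:R.

Definition centered (R : realType) (d : nat) (phi : circle R -> 'rV[R]_d)
    : Prop :=
  forall j : 'I_d, (\int[@haar_circle R]_x (phi x ord0 j)%:E = 0)%E.

Section skew_product.
Context (R : realType) (V : topologicalZmodType).
Variables (alpha : R) (phi : circle R -> V).

Lemma in_closed_generated_range (x : circle R) :
  in_closed_generated (range phi) (phi x).
Proof. by apply/mem_set; apply: sub_closed_generated; exists x. Qed.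

Definition cocycle (x : circle R) : closed_subgroup (range phi) :=
  Sub (phi x) (in_closed_generated_range x).

Definition skew_product (p : circle R * closed_subgroup (range phi))
    : circle R * closed_subgroup (range phi) :=
  (rotation alpha p.1, p.2 + cocycle p.1).

End skew_product.
Arguments cocycle {R V} phi x.
Arguments skew_product {R V} alpha phi p.

Section continued_fraction.
Variables (R : realType) (alpha : R).

(** Orbit of [alpha] modulo 1 under the Gauss map. *)
Definition gauss_orbit (n : nat) : R := iter n (fun x => frac x^-1) (frac alpha).

(** [cf_digit n] is the digit a_(n+1). *)
Definition cf_digit (n : nat) : nat := Num.truncn (gauss_orbit n)^-1.

Fixpoint cf_denom (n : nat) : nat :=
  match n with
  | 0 => 1
  | m.+1 => match m with
            | 0 => cf_digit 0
            | k.+1 => cf_digit m * cf_denom m + cf_denom k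
            end
  end.

(** The largest 1 <= m < n with q_m / q_n < 1 / Q; it is 0 for the finitely
    many [n] without such an [m]. *)
Definition cf_prev (Q n : nat) : nat :=
  (\max_(1 <= m < n | ((cf_denom m)%:R / (cf_denom n)%:R < Q%:R^-1 :> R)%R) m)%N.

Definition SBAD (Q : nat) : Prop :=
  irrational alpha /\
  (0 < limn_esup (fun n =>
         ((cf_denom (cf_prev Q n))%:R / (cf_denom n.+1)%:R : R)%:E))%E.

End continued_fraction.

(* Main.v *)
Require Import Defs.
From HB Require Import structures.
From mathcomp Require Import all_boot all_order all_algebra.
From mathcomp Require Import all_classical all_reals all_analysis.
From mathcomp Require Import measurable_realfun.
From mathcomp Require Import zify ring lra.

Set Implicit Arguments.
Unset Strict Implicit.
Unset Printing Implicit Defensive.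

Import Order.TTheory GRing.Theory Num.Theory.
Import numFieldNormedType.Exports.

Local Open Scope classical_set_scope.
Local Open Scope ring_scope.

(** Both properties of the skew product [T] come from _good times_ [t]
    ([good_time]): the Birkhoff sums [cocycle_sum t] are bounded independently
    of [t], and their jumps, which occur at the points [k / Q - j alpha] with
    [j < t], are at distance at least [h = c / t] from one another modulo 1, for
    a constant [c > 0].

    Conservativity. A bounded Birkhoff sum moves a bounded part of the fibres
    within a slab of finite measure. Along infinitely many good times the
    preimages of a wandering set would be disjoint sets of equal measure in such
    a slab ([skew_product_conservative]).

    Ergodicity. Let [A] be invariant up to a null set. On a point at distance at
    most [h] to the left of a jump at [k / Q], rotating by [h] and then applying
    [T^t] amounts to applying [T^t], then rotating by [h], then translating the
    fibre by [D = Phi k - Phi (k - 1)]. As [h] tends to 0 the rotation by [h]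
    moves little of [A] ([translation_small]), so [A] almost agrees with its
    translate by [D] over the points to the left of such jumps, which fill the
    same proportion [c] of the circle at every good time. The set of base points
    over which [A] differs from its translate is invariant under the rotation by
    [alpha], hence null or conull, and the latter is excluded by [c > 0]
    ([jump_invariant]). Therefore [T] acts on [A] as the translation by
    [(alpha, Phi 0)]; since the [Q] values of [Phi] sum to 0, the [Q]-th power of
    this translation is, modulo the differences [D], the translation by
    [(Q alpha, 0)]. The translations preserving [A] form a closed group, so they
    include all rotations as [Q alpha] is irrational, then the translations by
    all values of [Phi], then all translations; and a set invariant under all
    translations is null or conull by Fubini ([translation_ergodic]).

    Good times. Let [q] run through the denominators of the convergents of
    [alpha]. A floor sum over the orbit of length [q] is compared with the one
    for the convergent [p / q], computed exactly by Hermite's identity, which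
    gives bounded sums at the times [q], and also at the times [b q] when [Q]
    divides [q] and [b q] is at most the next denominator ([orbit_count]). The
    separation of the jumps says that [Q i alpha] is far from the integers for
    [0 < i < t]; it holds if [Q t] is at most a denominator that is comparable
    to [t], or if [t] is a denominator prime to [Q] and much smaller than the
    next one. In the case of [SBAD], [t] is the denominator before the ratio
    [1 / Q]. For a prime [Q], either the denominators eventually grow at a
    bounded rate and all of them are good, or there are infinitely many [q]
    much smaller than the next denominator: [q] itself is good when prime to
    [Q], and a large multiple of [q] is good when [Q] divides it. *)

(** * Hermite sums *)

Section hermite_sum.
Variables (R : realType) (q : nat) (p : int).
Hypotheses (q_gt0 : (0 < q)%N) (qp : coprimez q p).

Definition hermite_sum (x : R) : int :=
  \sum_(j < q) Num.floor (x + j%:R * (p%:~R / q%:R)).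

Let qR_neq0 : q%:R != 0 :> R. Proof. by rewrite pnatr_eq0 -lt0n. Qed.

Lemma le_hermite_sum (x y : R) : x <= y -> hermite_sum x <= hermite_sum y.
Proof. by move=> xy; apply: ler_sum => j _; apply: le_floor; rewrite lerD2r. Qed.

Lemma floorDint (x : R) (n : int) : Num.floor (x + n%:~R) = Num.floor x + n.
Proof. by rewrite floorDrz ?intrKfloor. Qed.

Lemma hermite_sumD1 (x : R) (n : int) :
  hermite_sum (x + n%:~R) = hermite_sum x + n * q%:Z.
Proof.
rewrite /hermite_sum; under eq_bigr do rewrite addrAC floorDint.
by rewrite big_split/= sumr_const card_ord mulrC -[q in RHS]mulr1n; congr (_ + _); lia.
Qed.

(** The shift by [p / q] increments the index of summation. *)
Lemma hermite_sumDp (x : R) :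
  hermite_sum (x + p%:~R / q%:R) = hermite_sum x + p.
Proof.
rewrite /hermite_sum; pose f j := Num.floor (x + j%:R * (p%:~R / q%:R)).
transitivity (\sum_(j < q) f j.+1).
  by apply: eq_bigr => j _; rewrite /f -natr1 mulrDl mul1r addrA addrAC.
have : \sum_(j < q.+1) f j = \sum_(j < q) f j + f q by rewrite big_ord_recr.
have -> : f q = f 0%N + p by rewrite /f mul0r addr0 mulrC divfK// floorDint.
rewrite big_ord_recl; under eq_bigr do rewrite lift0.
by move=> e; apply: (@addrI _ (f 0%N)); rewrite e addrCA.
Qed.

Lemma hermite_sumDpn (x : R) (n : int) :
  hermite_sum (x + (n * p)%:~R / q%:R) = hermite_sum x + n * p.
Proof.
have nat_case (k : nat) y :
    hermite_sum (y + (k%:Z * p)%:~R / q%:R) = hermite_sum y + k%:Z * p.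
  elim: k => [|k IH] in y *; first by rewrite !(mul0r, mulr0z, addr0).
  rewrite -addn1 PoszD !mulrDl mul1r intrD mulrDl addrA hermite_sumDp IH.
  by rewrite addrA.
case: n => n; first exact: nat_case.
have := nat_case n.+1 (x + (Negz n * p)%:~R / q%:R).
rewrite -addrA -mulrDl -intrD NegzE mulNr addNr mulr0z mul0r addr0 => ->; lia.
Qed.

(** Coprimality makes [1/q] an integral combination of the quasi-periods [p/q]
    and [1]. *)
Lemma hermite_sumDn (x : R) (n : int) :
  hermite_sum (x + n%:~R / q%:R) = hermite_sum x + n.
Proof.
have /coprimezP[[u v] /= uv] := qp.
have -> : n%:~R / q%:R = (n * v * p)%:~R / q%:R + (n * u)%:~R :> R.
  rewrite -[X in X%:~R / _ = _]mulr1 -uv -[(n * u)%:~R](mulfK qR_neq0) -mulrDl.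
  by congr (_ / _); rewrite (_ : q%:R = q%:Z%:~R)// -intrM -intrD; congr _%:~R; ring.
by rewrite addrA hermite_sumD1 hermite_sumDpn -[n in RHS]mulr1 -uv; ring.
Qed.

(** By monotonicity, knowing the increments over the steps [1 / q] is enough. *)
Lemma hermite_sum_quasilinear (x y : R) :
  `|(hermite_sum x - hermite_sum y)%:~R - q%:R * (x - y)| <= 1.
Proof.
have q0 : 0 < q%:R :> R by rewrite ltr0n.
have /andP[n1 n2] := floor_itv (q%:R * (x - y)).
move: n1 n2; set n := Num.floor _ => n1 n2.
have H1 : hermite_sum y + n <= hermite_sum x.
  rewrite -hermite_sumDn; apply: le_hermite_sum.
  by rewrite -lerBrDl ler_pdivrMr// mulrC.
have H2 : hermite_sum x <= hermite_sum y + (n + 1).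
  rewrite -hermite_sumDn; apply: le_hermite_sum.
  by rewrite -lerBlDl ler_pdivlMr// mulrC ltW.
have H1' : n%:~R <= (hermite_sum x - hermite_sum y)%:~R :> R by rewrite ler_int; lia.
have H2' : (hermite_sum x - hermite_sum y)%:~R <= (n + 1)%:~R :> R.
  by rewrite ler_int; lia.
by rewrite ler_norml; rewrite intrD in n2 H2'; lra.
Qed.

End hermite_sum.

(** * Orbit points in an interval *)

Section orbit_count.
Variables (R : realType) (alpha : R).

Definition floor_sum (t : nat) (x : R) : int :=
  \sum_(j < t) Num.floor (x + j%:R * alpha).

Lemma floor_sumD (s t : nat) (x : R) :
  floor_sum (s + t) x = floor_sum s x + floor_sum t (x + s%:R * alpha).
Proof.
rewrite /floor_sum big_split_ord/=; congr (_ + _); apply: eq_bigr => j _.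
by rewrite natrD mulrDl addrA.
Qed.

Variables (q b : nat) (p : int).
Hypotheses (q_gt0 : (0 < q)%N) (qp : coprimez q p).
Hypothesis drift : b%:R * q%:R * `|q%:R * alpha - p%:~R| <= 1.

Let qR : 0 < q%:R :> R. Proof. by rewrite ltr0n. Qed.
Let H := hermite_sum q p : R -> int.
Let e := q%:R * alpha - p%:~R.

Let node (x : R) (j : nat) :
  x + j%:R * alpha = x + j%:R / q%:R * e + j%:R * (p%:~R / q%:R).
Proof. by rewrite /e; field; rewrite gt_eqF. Qed.

Let jq (j : 'I_q) : 0 <= (j%:R / q%:R : R) <= 1.
Proof.
by rewrite divr_ge0// ler_pdivrMr// mul1r ler_nat ltnW.
Qed.

(** The first [q] points of the orbit of [x] drift away from the nodes of the
    Hermite sum by at most [e], always in the same direction. *)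
Let block_ge0 (x : R) : 0 <= e -> H x <= floor_sum q x <= H (x + e).
Proof.
move=> e0; apply/andP; split; apply: ler_sum => j _; apply: le_floor;
  rewrite node lerD2r; have := jq j; nra.
Qed.

Let block_le0 (x : R) : e <= 0 -> H (x + e) <= floor_sum q x <= H x.
Proof.
move=> e0; apply/andP; split; apply: ler_sum => j _; apply: le_floor;
  rewrite node lerD2r; have := jq j; nra.
Qed.

Let A (n : nat) (x : R) : int := \sum_(i < n) H (x + (i * q)%:R * alpha).

Let H_node (n : nat) (x : R) :
  H (x + (n * q)%:R * alpha) = H (x + n%:R * e) + n%:Z * p * q%:Z.
Proof.
rewrite -hermite_sumD1 // /e; congr (hermite_sum _ _ _).
by rewrite natrM intrM; ring.
Qed.

(** The drift [e] of a block of [q] points is also the difference, modulo 1,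
    between the starting points of consecutive blocks, so that the errors of
    [block_ge0] telescope. *)
Let blocks_ge0 (n : nat) (x : R) : 0 <= e ->
  A n x <= floor_sum (n * q) x <= A n x + (H (x + n%:R * e) - H x).
Proof.
move=> e0; elim: n => [|n IH].
  by rewrite /A /floor_sum mul0n !big_ord0 mul0r addr0 subrr addr0 lexx.
rewrite mulSnr floor_sumD /A big_ord_recr/=.
have := block_ge0 (x + (n * q)%:R * alpha) e0.
have := H_node n x; have := H_node n (x + e).
rewrite (_ : x + e + _ = x + (n * q)%:R * alpha + e); last by ring.
rewrite (_ : x + e + _ = x + n.+1%:R * e); last by rewrite -natr1; ring.
move: IH; rewrite /A; lra.
Qed.

Let blocks_le0 (n : nat) (x : R) : e <= 0 ->
  A n x + (H (x + n%:R * e) - H x) <= floor_sum (n * q) x <= A n x.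
Proof.
move=> e0; elim: n => [|n IH].
  by rewrite /A /floor_sum mul0n !big_ord0 mul0r addr0 subrr addr0 lexx.
rewrite mulSnr floor_sumD /A big_ord_recr/=.
have := block_le0 (x + (n * q)%:R * alpha) e0.
have := H_node n x; have := H_node n (x + e).
rewrite (_ : x + e + _ = x + (n * q)%:R * alpha + e); last by ring.
rewrite (_ : x + e + _ = x + n.+1%:R * e); last by rewrite -natr1; ring.
move: IH; rewrite /A; lra.
Qed.

Let H1 (x : R) : H (x + 1 / q%:R) = H x + 1.
Proof. by rewrite -(mulr1z 1) /H hermite_sumDn. Qed.

Let HN1 (x : R) : H (x - 1 / q%:R) = H x - 1.
Proof. by have := H1 (x - 1 / q%:R); rewrite subrK => ->; rewrite addrK. Qed.

Let be_bound : - (1 / q%:R) <= b%:R * e <= 1 / q%:R.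
Proof.
rewrite -ler_norml ler_pdivlMr// normrM normr_nat -/e mulrAC; exact: drift.
Qed.

Let floor_sum_A : (forall x, A b x <= floor_sum (b * q) x <= A b x + 1) \/
  (forall x, A b x - 1 <= floor_sum (b * q) x <= A b x).
Proof.
have /andP[be1 be2] := be_bound.
have [e0|/ltW e0] := leP 0 e; [left|right] => x.
- have := blocks_ge0 b x e0.
  have : H (x + b%:R * e) <= H (x + 1 / q%:R) by apply: le_hermite_sum; lra.
  by rewrite H1; lia.
- have := blocks_le0 b x e0.
  have : H (x - 1 / q%:R) <= H (x + b%:R * e) by apply: le_hermite_sum; lra.
  by rewrite HN1; lia.
Qed.

(** Denjoy-Koksma inequality for the interval [[0, 1/Q)], of which [floor y -
    floor (y - 1/Q)] is the indicator modulo 1. The floor sum is within 1 of a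
    sum of [b] Hermite sums. When [Q] divides [q], each of them varies by exactly
    [q / Q] over an interval of length [1 / Q]; otherwise there is an error of at
    most 1 for each, which is affordable for a single block. *)
Lemma orbit_count (Q : nat) (x : R) : (0 < Q)%N -> b = 1%N \/ (Q %| q)%N ->
  `|(floor_sum (b * q) x - floor_sum (b * q) (x - 1 / Q%:R))%:~R
     - (b * q)%:R / Q%:R| <= 2 :> R.
Proof.
move=> Q0 bQ; set y := x - 1 / Q%:R.
have QR : Q%:R != 0 :> R by rewrite pnatr_eq0 -lt0n.
have A1 : `|(A b x - A b y)%:~R - (b * q)%:R / Q%:R| <= 1 :> R.
  case: bQ => [->|/dvdnP[k qk]].
    rewrite /A !big_ord1 mul0n mul1n !mul0r !addr0.
    have := hermite_sum_quasilinear q_gt0 qp x y.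
    by rewrite (_ : q%:R * (x - y) = q%:R / Q%:R)// /y; ring.
  have Hy z : H (z - 1 / Q%:R) = H z - k%:Z.
    have kQ : 1 / Q%:R = k%:Z%:~R / q%:R :> R.
      rewrite qk natrM -pmulrn; field; apply/andP; split=> //.
      by move: q_gt0; rewrite qk muln_gt0 => /andP[k0 _]; rewrite pnatr_eq0 -lt0n.
    by rewrite kQ -mulNr -mulrNz /H hermite_sumDn.
  have -> : A b y = A b x - b%:Z * k%:Z.
    rewrite /A; under eq_bigr do rewrite /y addrAC Hy.
    rewrite big_split/= sumr_const card_ord; congr (_ + _); lia.
  rewrite opprB addrCA subrr addr0 intrM qk !natrM !mulrA mulfK// -!pmulrn subrr normr0.
  exact: ler01.
have fA : `|(floor_sum (b * q) x - floor_sum (b * q) y) - (A b x - A b y)| <= 1.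
  by case: floor_sum_A => F; have := F x; have := F y; lia.
move: fA A1; rewrite -(ler_int R) intr_norm !intrB => fA A1.
by move: fA A1; rewrite !ler_norml; lra.
Qed.

End orbit_count.

(** * Convergents *)

Local Notation frac := Defs.frac.

Section convergents.
Variables (R : realType) (alpha : R).
Hypothesis irr : irrational alpha.

Let g := gauss_orbit alpha.
Let q := cf_denom alpha.

Let irrational_frac (x : R) : irrational x -> irrational (frac x).
Proof.
move=> ix [r /= _ rx]; apply: ix; exists (r + (Num.floor x)%:~R) => //=.
by rewrite rmorphD/= rx ratr_int /frac subrK.
Qed.

Let irrational_inv (x : R) : irrational x -> irrational x^-1.
Proof.
move=> ix [r /= _ rx]; apply: ix; by exists r^-1; rewrite // fmorphV/= rx invrK.
Qed.

Let g_irrational n : irrational (g n).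
Proof.
elim: n => [|n IH]; first exact: irrational_frac.
exact/irrational_frac/irrational_inv.
Qed.

Let g_itv n : 0 < g n < 1.
Proof.
have : 0 <= g n < 1 by case: n => [|n]; exact: frac_itv.
rewrite le_eqVlt => /andP[/orP[/eqP g0|->//] _].
by have := g_irrational (n := n); rewrite -g0; case; exists 0 => //=; rewrite rmorph0.
Qed.

Let digitE n : (g n)^-1 = (cf_digit alpha n)%:R + g n.+1.
Proof.
have /andP[g0 _] := g_itv n; have gV : 0 <= (g n)^-1 by rewrite invr_ge0 ltW.
rewrite /g /= -/(g n) /frac /cf_digit -/g truncn_floor gV.
by rewrite natr_absz ger0_norm ?floor_ge0// addrC subrK.
Qed.

Let digit_gt0 n : (0 < cf_digit alpha n)%N.
Proof.
have /andP[g0 g1] := g_itv n.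
by rewrite /cf_digit truncn_gt0 -/(g n) invf_ge1// ltW.
Qed.

Lemma cf_denomSS n : q n.+2 = (cf_digit alpha n.+1 * q n.+1 + q n)%N.
Proof. by []. Qed.

Lemma cf_denom_gt0 n : (0 < q n)%N.
Proof.
suff : ((0 < q n) && (0 < q n.+1))%N by case/andP.
elim: n => [|n /andP[IH1 IH2]]; first by rewrite /q/= digit_gt0.
by rewrite IH2 cf_denomSS addn_gt0 IH1 orbT.
Qed.

Lemma cf_denom_leS n : (q n <= q n.+1)%N.
Proof.
case: n => [|n]; first by rewrite /q/= digit_gt0.
by rewrite cf_denomSS; apply: leq_trans (leq_addr _ _); rewrite leq_pmull.
Qed.

Lemma cf_denom_le m n : (m <= n)%N -> (q m <= q n)%N.
Proof. exact: (homo_leq leqnn leq_trans cf_denom_leS). Qed.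

Lemma cf_denom_double n : (2 * q n <= q n.+2)%N.
Proof.
rewrite cf_denomSS mul2n -addnn leq_add2r.
by apply: leq_trans (cf_denom_leS n) _; rewrite leq_pmull.
Qed.

Lemma cf_denom_exp m k : (2 ^ k * q m <= q (m + k.*2))%N.
Proof.
elim: k => [|k IH]; first by rewrite mul1n addn0.
rewrite doubleS !addnS expnS -mulnA (leq_trans _ (cf_denom_double _))//.
by rewrite leq_mul2l IH.
Qed.

Lemma cf_denom_unbounded N : exists n, (N <= q n)%N.
Proof.
exists (0 + N.*2)%N; apply: leq_trans (cf_denom_exp 0 N).
by rewrite muln1 ltnW// ltn_expl.
Qed.

(** The numerators for [alpha] itself and not for its fractional part, so that
    the integer part of [alpha] enters the initial values. *)
Fixpoint cf_num (n : nat) : int :=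
  match n with
  | 0 => Num.floor alpha
  | m.+1 => match m with
            | 0 => (cf_digit alpha 0)%:Z * Num.floor alpha + 1
            | k.+1 => (cf_digit alpha m)%:Z * cf_num m + cf_num k
            end
  end.

Let cf_numSS n :
  cf_num n.+2 = (cf_digit alpha n.+1)%:Z * cf_num n.+1 + cf_num n.
Proof. by []. Qed.

Let delta n := (q n)%:R * alpha - (cf_num n)%:~R.

(** The Gauss map computes the ratios of the successive approximation errors. *)
Let deltaS n : delta n.+1 = - (g n.+1 * delta n).
Proof.
have gV k : (cf_digit alpha k)%:R = (g k)^-1 - g k.+1 by rewrite digitE addrK.
have g0 k : g k != 0 by have /andP[/gt_eqF->] := g_itv k.
elim: n => [|n IH].
  set g1 := g 1%N; rewrite /delta /q /= intrD intrM mulr1z.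
  rewrite -[_%:~R]/((cf_digit alpha 0)%:R) gV.
  have -> : (Num.floor alpha)%:~R = alpha - g 0%N by rewrite /g /= /frac; ring.
  by rewrite -/g1; field.
have gn : delta n = - delta n.+1 / g n.+1 by rewrite IH; field.
rewrite /delta cf_denomSS cf_numSS natrD natrM intrD intrM.
rewrite -[(Posz _)%:~R]/((cf_digit alpha n.+1)%:R).
transitivity ((cf_digit alpha n.+1)%:R * delta n.+1 + delta n).
  by rewrite /delta; ring.
by rewrite -/(delta n.+1) gn gV; field.
Qed.

Let det n : (q n)%:Z * cf_num n.+1 - (q n.+1)%:Z * cf_num n = (-1) ^+ n.
Proof.
elim: n => [|n IH]; first by rewrite /q/= mul1r expr0; ring.
rewrite exprS -IH cf_denomSS cf_numSS PoszD PoszM; ring.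
Qed.

Lemma cf_coprime n : coprimez (q n) (cf_num n).
Proof.
have e : (-1) ^+ n * cf_num n.+1 * (q n)%:Z
    + - (-1) ^+ n * (q n.+1)%:Z * cf_num n = 1.
  by rewrite -[RHS](sqrr_sign _ n) expr2 -[X in _ = _ * X](det n); ring.
by apply/coprimezP; exists ((-1) ^+ n * cf_num n.+1, - (-1) ^+ n * (q n.+1)%:Z).
Qed.

Lemma cf_approx n : (q n.+1)%:R * `|(q n)%:R * alpha - (cf_num n)%:~R| <= 1.
Proof.
have /andP[g0 g1] := g_itv n.+1.
have /(congr1 Num.norm) : ((q n.+1)%:R + (q n)%:R * g n.+1) * delta n = ((-1) ^+ n)%:~R.
  rewrite -(det n) intrB !intrM -[(Posz (q n))%:~R]/((q n)%:R)
    -[(Posz (q n.+1))%:~R]/((q n.+1)%:R).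
  transitivity ((q n.+1)%:R * delta n - (q n)%:R * delta n.+1).
    by rewrite deltaS; ring.
  by rewrite /delta; ring.
rewrite normrM intr_sign normr_sign [X in X * _]ger0_norm; last first.
  by rewrite addr_ge0// mulr_ge0// ltW.
move=> e; rewrite -/(delta n) -[X in _ <= X]e ler_wpM2r// lerDl mulr_ge0// ltW//.
Qed.

End convergents.

(** As [q] does not divide [n p], the number [n p / q] is at distance at least
    [1 / q] from the integers; replacing [p / q] by [alpha] costs [n] times the
    error of the approximation. *)
Lemma dist_int_ge (R : realType) (alpha : R) (q n : nat) (p a : int) :
  coprimez q p -> ~~ (q %| n)%N ->
  1 - n%:R * `|q%:R * alpha - p%:~R| <= q%:R * `|n%:R * alpha - a%:~R|.
Proof.
move=> qp qn; have : 1 <= `|n%:Z * p - q%:Z * a|.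
  rewrite -gtz0_ge1 normr_gt0; apply: contra qn => /eqP/subr0_eq e.
  have : (q %| n%:Z * p)%Z by rewrite e dvdz_mulr.
  by rewrite Gauss_dvdzl.
rewrite -(ler_int R) intr_norm intrB !intrM mulr1z.
rewrite -[(Posz n)%:~R]/(n%:R) -[(Posz q)%:~R]/(q%:R) => h.
rewrite lerBlDr -[X in X * `|_ * _ - a%:~R|]ger0_norm// -[X in _ + X * _]ger0_norm//.
rewrite -!normrM; apply: le_trans h _.
apply: le_trans (ler_normB _ _); rewrite le_eqVlt; apply/orP; left; apply/eqP.
by congr `|_|; ring.
Qed.

(** The convergent of index [n] is accurate enough when the next denominator is
    at least twice [q n]. Otherwise the next convergent is used: its denominator
    is less than [2 * q n], and its error is at most [1 / q n.+2], where [q n.+2]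
    is at least [2 * q n]. *)
Lemma dist_int_cf (R : realType) (alpha : R) (n i : nat) (a : int) :
  irrational alpha -> (0 < i < cf_denom alpha n)%N ->
  1 <= 4 * (cf_denom alpha n)%:R * `|i%:R * alpha - a%:~R|.
Proof.
move=> irr /andP[i0 iq]; set q := cf_denom alpha.
have qR k : 1 <= (q k)%:R :> R by rewrite ler1n cf_denom_gt0.
have iqR : i%:R <= (q n)%:R :> R by rewrite ler_nat ltnW.
have i0R : 0 <= i%:R :> R by [].
have d0 := normr_ge0 (i%:R * alpha - a%:~R).
have ndvd k : (n <= k)%N -> ~~ (q k %| i)%N.
  by move=> nk; rewrite gtnNdvd// (leq_trans iq)// cf_denom_le.
have [big|/ltnW small] := leqP (2 * q n) (q n.+1).
  have := dist_int_ge alpha a (cf_coprime alpha n) (ndvd n (leqnn _)).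
  have := cf_approx irr n; have := normr_ge0 ((q n)%:R * alpha - (cf_num alpha n)%:~R).
  rewrite -/q; move: big; rewrite -(ler_nat R) natrM.
  have := qR n; nra.
have := dist_int_ge alpha a (cf_coprime alpha n.+1) (ndvd n.+1 (leqnSn _)).
have := cf_approx irr n.+1.
have := normr_ge0 ((q n.+1)%:R * alpha - (cf_num alpha n.+1)%:~R).
have := cf_denom_double irr n; rewrite -/q.
move: small; rewrite -!(ler_nat R) !natrM.
have := qR n; nra.
Qed.

(** * Good times *)

(** The fourth clause, divided by [Q], says that the points [a / Q - j alpha] with
    [j < t] and integral [a] are at distance at least [h] when their indices [j]
    differ. The last clause says that the orbit segments of length [t] visit the
    intervals of length [1 / Q] equally often up to a bounded error. *)
Definition good_time (R : realType) (alpha : R) (Q t : nat) (h : R) : Prop :=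
  [/\ (0 < t)%N, 0 < h, h <= 1 / Q%:R,
      forall (i : nat) (a : int), (0 < i < t)%N ->
        Q%:R * h <= `|(Q * i)%:R * alpha - a%:~R| &
      forall x : R,
        `|(floor_sum alpha t x - floor_sum alpha t (x - 1 / Q%:R))%:~R
           - t%:R / Q%:R| <= 2 :> R].

Section good_times.
Variables (R : realType) (alpha : R) (Q : nat).
Hypotheses (irr : irrational alpha) (Q_gt1 : (1 < Q)%N).
Let q := cf_denom alpha.

Let QR : 1 < Q%:R :> R. Proof. by rewrite ltr1n. Qed.

Let step_bounds (C : R) (t : nat) : (0 < t)%N -> 1 <= C ->
  0 < (4 * C * Q%:R)^-1 / t%:R <= 1 / Q%:R.
Proof.
move=> t0 C1; have Q1 := QR; have tR : 1 <= t%:R :> R by rewrite ler1n.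
have C0 : 0 < 4 * C by lra.
apply/andP; split; first by rewrite divr_gt0// ?invr_gt0 ?mulr_gt0//; lra.
rewrite invfM mulrAC ler_pM2r; last by rewrite invr_gt0; lra.
by rewrite -invfM invf_le1; [nra|rewrite mulr_gt0//; lra].
Qed.

(** For [0 < i < t] the multiple [Q i] is less than [q k], so that [dist_int_cf]
    puts [Q i alpha] at distance [1 / (4 q k)], at least [1 / (4 C t)], from the
    integers. *)
Let good_time_le (C : R) (t k : nat) :
  (0 < t)%N -> 1 <= C -> (Q * t <= q k)%N -> (q k)%:R <= C * t%:R ->
  (forall x : R,
        `|(floor_sum alpha t x - floor_sum alpha t (x - 1 / Q%:R))%:~R
           - t%:R / Q%:R| <= 2 :> R) ->
  good_time alpha Q t ((4 * C * Q%:R)^-1 / t%:R).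
Proof.
move=> t0 C1 Qt qC count; have /andP[h0 h1] := step_bounds t0 C1.
split=> // i a /andP[i0 it].
have Q1 := QR; have tR : 1 <= t%:R :> R by rewrite ler1n.
have -> : Q%:R * ((4 * C * Q%:R)^-1 / t%:R) = 1 / (4 * (C * t%:R)) :> R.
  by field; rewrite !gt_eqF//; lra.
have Qi : (0 < Q * i < q k)%N.
  by rewrite muln_gt0 (ltnW Q_gt1) i0 (leq_trans _ Qt)// ltn_pmul2l// ltnW.
have := dist_int_cf a irr Qi; rewrite -/q.
have := normr_ge0 ((Q * i)%:R * alpha - a%:~R).
rewrite ler_pdivrMr; last by nra.
have : 1 <= (q k)%:R :> R by rewrite ler1n cf_denom_gt0.
nra.
Qed.

Let count_block (b m : nat) : (0 < b)%N -> (b * q m <= q m.+1)%N ->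
  b = 1%N \/ (Q %| q m)%N -> forall x : R,
  `|(floor_sum alpha (b * q m) x - floor_sum alpha (b * q m) (x - 1 / Q%:R))%:~R
           - (b * q m)%:R / Q%:R| <= 2 :> R.
Proof.
move=> b0 bq bQ x; apply: (orbit_count (p := cf_num alpha m)) => //.
- exact: cf_denom_gt0.
- exact: cf_coprime.
- rewrite -natrM; apply: le_trans (cf_approx irr m).
  by rewrite ler_wpM2r// ler_nat.
- exact: ltnW.
Qed.

Let good_denom (C : R) (m k : nat) : 1 <= C -> (Q * q m <= q k)%N ->
  (q k)%:R <= C * (q m)%:R ->
  good_time alpha Q (q m) ((4 * C * Q%:R)^-1 / (q m)%:R).
Proof.
move=> C1 Qm mk; apply: (good_time_le (k := k)) => //; first exact: cf_denom_gt0.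
have := @count_block 1 m isT; rewrite mul1n; apply; last by left.
exact: cf_denom_leS.
Qed.

(** The largest multiple [t] of [q m] with [Q t <= q m.+1] is comparable to
    [q m.+1]. *)
Let good_multiple (m : nat) : (2 * Q * q m <= q m.+1)%N -> (Q %| q m)%N ->
  exists2 t, (q m <= t)%N &
    good_time alpha Q t ((4 * (2 * Q)%:R * Q%:R)^-1 / t%:R).
Proof.
move=> big Qq; have q0 := cf_denom_gt0 irr m; rewrite -/q in q0.
have Q0 := ltnW Q_gt1.
set b := (q m.+1 %/ (Q * q m))%N.
have b1 : (b * (Q * q m) <= q m.+1)%N by exact: leq_divM.
have b2 : (q m.+1 < b.+1 * (Q * q m))%N by rewrite ltn_ceil// muln_gt0 Q0.
have b0 : (0 < b)%N by rewrite divn_gt0 ?muln_gt0 ?Q0//; nia.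
exists (b * q m)%N; first by rewrite leq_pmull.
apply: (good_time_le (k := m.+1)) => //.
- by rewrite muln_gt0 b0.
- by rewrite ler1n; lia.
- by rewrite mulnCA.
- by rewrite -natrM ler_nat; nia.
- by apply: count_block => //; [nia|right].
Qed.

(** Here [Q t] exceeds the next denominators that are comparable to [t], but the
    fraction with denominator [q m] itself separates the points [Q i alpha]: [q m]
    does not divide [Q i] for [0 < i < q m]. *)
Let good_coprime (m : nat) : (2 * Q * q m <= q m.+1)%N -> coprime (q m) Q ->
  good_time alpha Q (q m) ((4 * (2 * Q)%:R * Q%:R)^-1 / (q m)%:R).
Proof.
move=> big qQ; have q0 := cf_denom_gt0 irr m; rewrite -/q in q0.
have C1 : 1 <= (2 * Q)%:R :> R by rewrite ler1n; lia.
have /andP[h0 h1] := step_bounds q0 C1.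
split=> // [i a /andP[i0 iq]|]; last first.
  have := @count_block 1 m isT; rewrite mul1n; apply; last by left.
  exact: cf_denom_leS.
have Q1 := QR; have qR : 1 <= (q m)%:R :> R by rewrite ler1n.
have -> : Q%:R * ((4 * (2 * Q)%:R * Q%:R)^-1 / (q m)%:R)
    = 1 / (4 * (2 * Q)%:R * (q m)%:R) :> R.
  by field; rewrite !gt_eqF//; lra.
have ndvd : ~~ (q m %| Q * i)%N by rewrite Gauss_dvdr// gtnNdvd.
have := dist_int_ge alpha a (cf_coprime alpha m) ndvd; rewrite -/q.
have ap := cf_approx irr m; rewrite -/q in ap.
have d0 := normr_ge0 ((q m)%:R * alpha - (cf_num alpha m)%:~R).
have Qi : 2 * (Q * i)%:R <= (q m.+1)%:R :> R by rewrite -natrM ler_nat; nia.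
have half : 2 * ((Q * i)%:R * `|(q m)%:R * alpha - (cf_num alpha m)%:~R|) <= 1.
  by rewrite mulrA; apply: le_trans ap; rewrite ler_wpM2r.
have x0 := normr_ge0 ((Q * i)%:R * alpha - a%:~R).
rewrite (natrM _ 2 Q) ler_pdivrMr; last by nra.
move: half; set y := _ * `|(q m)%:R * alpha - _| => half sep.
suff : 1 <= 2 * ((q m)%:R * `|(Q * i)%:R * alpha - a%:~R|) by nra.
by lra.
Qed.

(** A denominator that is not prime to the prime [Q] is divisible by [Q]. *)
Lemma good_times_prime : prime Q -> exists2 c : R, 0 < c &
  forall N, exists2 t, (N <= t)%N & good_time alpha Q t (c / t%:R).
Proof.
move=> pQ; have Q0 := ltnW Q_gt1.
have [inf|/existsNP[N /forallNP fin]] :=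
    pselect (forall N, exists m, (N <= m)%N /\ (2 * Q * q m <= q m.+1)%N).
  exists (4 * (2 * Q)%:R * Q%:R)^-1.
    by rewrite invr_gt0 !mulr_gt0// ltr0n; lia.
  move=> N; have [n Nn] := cf_denom_unbounded irr N.
  have [m [nm big]] := inf n.
  have Nm : (N <= q m)%N by rewrite (leq_trans Nn)// cf_denom_le.
  have [qQ|] := boolP (coprime (q m) Q).
    by exists (q m) => //; exact: good_coprime.
  rewrite coprime_sym prime_coprime// negbK => /(good_multiple big)[t mt gt].
  by exists t => //; exact: leq_trans mt.
(* Over [2 Q] indices the denominators grow by a factor of at least [2 ^ Q > Q]
   and, the ratios being at most [2 Q], of at most [(2 Q) ^ (2 Q)]. *)
pose C : R := ((2 * Q) ^ Q.*2)%:R.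
exists (4 * C * Q%:R)^-1.
  by rewrite invr_gt0 !mulr_gt0// ltr0n// expn_gt0; lia.
move=> M; have [n Mn] := cf_denom_unbounded irr M.
set m := maxn n N.
exists (q m); first by rewrite (leq_trans Mn)// cf_denom_le// leq_maxl.
apply: (good_denom (k := (m + Q.*2)%N)).
- by rewrite ler1n expn_gt0; lia.
- rewrite (leq_trans _ (cf_denom_exp irr m Q))// leq_mul2r.
  by rewrite ltnW ?orbT// ltn_expl.
rewrite -natrM ler_nat; elim: Q.*2 => [|k IH]; first by rewrite addn0 mul1n.
have Nmk : (N <= m + k)%N by rewrite (leq_trans (leq_maxr n N))// leq_addr.
have := fin (m + k)%N; rewrite Nmk addnS expnS => /not_andP[//|/negP].
rewrite -ltnNge => /ltnW h; apply: leq_trans h _.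
by rewrite -[X in (_ <= X)%N]mulnA leq_mul2l IH orbT.
Qed.

Let cf_prev_lt n : (0 < cf_prev alpha Q n)%N ->
  (Q * q (cf_prev alpha Q n) < q n)%N.
Proof.
rewrite /cf_prev; elim/big_ind: _ => // [x y Hx Hy|m].
  by rewrite /maxn; case: ifP.
rewrite ltr_pdivrMr ?ltr0n ?cf_denom_gt0// mulrC ltr_pdivlMr; last first.
  by rewrite ltr0n ltnW.
by rewrite -natrM ltr_nat mulnC.
Qed.

(** If the denominator [q_m] preceding the ratio [1 / Q] satisfies
    [q_m >= e q_(k+1)], then [Q q_m < q_k <= q_(k+1) <= q_m / e]. *)
Lemma good_times_SBAD : SBAD alpha Q -> exists2 c : R, 0 < c &
  forall N, exists2 t, (N <= t)%N & good_time alpha Q t (c / t%:R).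
Proof.
move=> [_]; rewrite limn_esup_lim; set u := (X in esups X) => u0.
have [e e0 eu] : exists2 e : R, 0 < e &
    forall n, exists2 k, (n <= k)%N & (e%:E <= u k)%E.
  have [e [e0 el]] : exists e : R, 0 < e /\ (e%:E < limn (esups u))%E.
    move: u0; case: (limn _) => [r|_|//].
      by rewrite lte_fin => r0; exists (r / 2); rewrite lte_fin; split; lra.
    by exists 1; rewrite ltry.
  exists e => // n.
  have : (e%:E < esups u n)%E.
    apply: lt_le_trans el _; rewrite (cvg_lim _ (@cvg_esups_inf _ u))//.
    by apply: ereal_inf_lbound; exists n.
  by move=> /ereal_sup_gt[_ [k /= nk <-] /ltW ek]; exists k.
have Q0 : (0 < Q)%N by exact: ltnW.
pose C : R := Num.max 1 e^-1.
exists (4 * C * Q%:R)^-1.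
  by rewrite invr_gt0 !mulr_gt0// ?ltr0n// lt_max ltr01.
(* A denominator [q_(k+1)] beyond [(N + 1) / e] forces [q_m > N + 1]; in
   particular [m] is not the default value 0 of [cf_prev]. *)
move=> N; have [n0 Nn0] := cf_denom_unbounded irr (Num.truncn (N.+1%:R / e)).+1.
have [k n0k] := eu n0; rewrite lee_fin -/q; set m := cf_prev alpha Q k => ek.
have qk : N.+1%:R / e < (q k.+1)%:R.
  apply: lt_le_trans (truncnS_gt _) _; rewrite ler_nat (leq_trans Nn0)//.
  by rewrite cf_denom_le// leqW.
rewrite ltr_pdivrMr// in qk.
have q0 : 0 < (q k.+1)%:R :> R by rewrite ltr0n cf_denom_gt0.
rewrite ler_pdivlMr// mulrC in ek.
have Nm : (N.+1 < q m)%N by rewrite -(ltr_nat R) (lt_le_trans qk).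
exists (q m); first by rewrite ltnW// ltnW.
have m0 : (0 < m)%N by move: Nm; case: (m).
apply: (good_denom (k := k)).
- by rewrite le_max lexx.
- by rewrite ltnW// cf_prev_lt.
have C1 : e^-1 <= C by rewrite le_max lexx orbT.
apply: (@le_trans _ _ (e^-1 * (q m)%:R)); last by rewrite ler_wpM2r.
rewrite mulrC ler_pdivlMr//; apply: le_trans ek; rewrite ler_wpM2r ?(ltW e0)//.
by rewrite ler_nat cf_denom_leS.
Qed.

End good_times.

(** * Rotations of the circle *)

Section circle_rotation.
Variable R : realType.
Implicit Types (x : circle R) (r s : R).

Lemma fracDint r (n : int) : frac (r + n%:~R) = frac r.
Proof. by rewrite /frac floorDint intrD opprD addrACA subrr addr0. Qed.

Lemma frac_id r : 0 <= r < 1 -> frac r = r.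
Proof. by move=> r01; rewrite /frac (@floor_def _ r 0) ?subr0// add0r. Qed.

Lemma circle_classDint r (n : int) : circle_class (r + n%:~R) = circle_class r.
Proof. by apply: val_inj; rewrite /= fracDint. Qed.

Lemma circle_valK : cancel (@circle_val R) (@circle_class R).
Proof. by move=> x; apply: val_inj; rewrite /= frac_id//; exact: (valP x). Qed.

Lemma circle_val_itv x : 0 <= circle_val x < 1.
Proof. exact: (valP x). Qed.

Lemma rotation_class s r : rotation s (circle_class r) = circle_class (r + s).
Proof.
rewrite /rotation -(circle_classDint (r + s) (- Num.floor r)) mulrNz addrAC.
by [].
Qed.

Lemma rotationD s r x : rotation s (rotation r x) = rotation (r + s) x.
Proof. by rewrite {2 3}/rotation rotation_class addrA. Qed.

Lemma rotation0 x : rotation 0 x = x.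
Proof. by rewrite /rotation addr0 circle_valK. Qed.

Lemma measurable_floor : measurable_fun [set: R] (fun r => (Num.floor r)%:~R : R).
Proof.
by apply: nondecreasing_measurable => // r s rs; rewrite ler_int; exact: le_floor.
Qed.

Lemma measurable_frac : measurable_fun [set: R] (@frac R).
Proof. by apply: measurable_funB => //; exact: measurable_floor. Qed.

Lemma measurable_circle_val :
  measurable_fun [set: circle R] (@circle_val R : _ -> measurableTypeR R).
Proof. by move=> _ B mB; exists B. Qed.

Lemma measurable_to_circle d (T : measurableType d) (f : T -> circle R) :
  measurable_fun setT (fun z => circle_val (f z) : measurableTypeR R) ->
  measurable_fun setT f.
Proof.
move=> mf _ _ [B mB <-]; rewrite !setTI -comp_preimage -[X in measurable X]setTI.
exact: mf.
Qed.

Lemma measurable_circle_class : measurable_fun [set: R] (@circle_class R).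
Proof. by apply: measurable_to_circle; exact: measurable_frac. Qed.

Lemma measurable_rotation s : measurable_fun setT (@rotation R s).
Proof.
apply: (measurableT_comp measurable_circle_class).
by apply: measurable_funD => //; exact: measurable_circle_val.
Qed.

Lemma lebesgue_measure_shift s (A : set R) : measurable A ->
  lebesgue_measure ((fun r : R => r + s) @^-1` A) = lebesgue_measure A.
Proof.
move=> mA.
pose f : measurableTypeR R -> measurableTypeR R := fun r => r + s.
have mf : measurable_fun setT f by exact: measurable_funD.
rewrite -[LHS]/(pushforward lebesgue_measure f A); apply/esym.
apply: (@lebesgue_measure_unique _ (pushforward lebesgue_measure f)) => // X.
move=> [[a b] /= ab <-]; rewrite /pushforward.
rewrite (_ : f @^-1` _ = `]a - s, b - s]%classic).
  rewrite !lebesgue_measure_itv/= !lte_fin ltrD2r; case: ifP => //= _.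
  by rewrite -!EFinB; congr (_%:E); ring.
by apply/seteqP; split=> r /=; rewrite !in_itv/= ltrBlDr lerBrDr.
Qed.

Lemma rotation_frac s : rotation (frac s) =1 rotation s.
Proof.
move=> x; rewrite /rotation -(circle_classDint _ (Num.floor s)) /frac.
by congr circle_class; ring.
Qed.

Let image_circle_val (B : set R) :
  @circle_val R @` (@circle_val R @^-1` B) = B `&` `[0, 1[%classic.
Proof.
apply/seteqP; split => [_ [x Bx <-]|x [Bx]].
  by split => //=; rewrite in_itv/=; exact: circle_val_itv.
by rewrite /= in_itv/= => x01; exists (Sub x x01).
Qed.

(** On the fundamental domain a rotation by [s] is the translation by [s] on
    [[0, 1 - s)] and the translation by [s - 1] on [[1 - s, 1)]. *)
Lemma haar_circle_rotation s (P : set (circle R)) : measurable P ->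
  haar_circle (@rotation R s @^-1` P) = haar_circle P :> \bar R.
Proof.
move=> mP; rewrite -(funext (rotation_frac s)).
have := frac_itv s; move: (frac s) => {}s s01.
case: mP => B mB <-; rewrite setTI /haar_circle image_circle_val.
have mBs : measurable (B `&` `[s, 1[%classic) by exact: measurableI.
have mB0 : measurable (B `&` `[0, s[%classic) by exact: measurableI.
have mshift r (A : set R) : measurable A ->
    measurable ((fun u : R => u + r) @^-1` A : set (measurableTypeR R)).
  by move=> mA; rewrite -[X in measurable X]setTI; exact: measurable_funD.
transitivity (lebesgue_measure ((fun u : R => u + s) @^-1` (B `&` `[s, 1[%classic)
    `|` (fun u : R => u + (s - 1)) @^-1` (B `&` `[0, s[%classic))).
  congr lebesgue_measure; rewrite comp_preimage; apply/seteqP; split.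
  - move=> _ [x Bx <-]; have := circle_val_itv x; set u := circle_val x => u01.
    have Bu : B (frac (u + s)) := Bx.
    have [us|us] := ltP (u + s) 1; [left|right].
      have e : frac (u + s) = u + s by apply: frac_id; lra.
      by rewrite e in Bu; split => //=; rewrite ?in_itv/=; lra.
    have e : frac (u + s) = u + (s - 1).
      rewrite -[RHS]frac_id; last by lra.
      by rewrite -(fracDint _ (-1)); congr frac; rewrite mulrN1z; ring.
    by rewrite e in Bu; split => //=; rewrite ?in_itv/=; lra.
  - move=> u [[/= Bu]|[/= Bu]]; rewrite ?in_itv/= => us.
      have u01 : 0 <= u < 1 by lra.
      by exists (Sub u u01) => //=; rewrite /circle_val/= frac_id//; lra.
    have u01 : 0 <= u < 1 by lra.
    exists (Sub u u01) => //=; rewrite /circle_val/=.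
    rewrite -(fracDint _ (-1)) frac_id ?mulrN1z -?addrA//; lra.
rewrite measureU; [|exact: mshift|exact: mshift|]; last first.
  by apply/seteqP; split => // u [[_ /=] + [_ /=]]; rewrite !in_itv/=; lra.
transitivity (lebesgue_measure (B `&` `[s, 1%R[%classic)
    + lebesgue_measure (B `&` `[0%R, s[%classic))%E.
  by rewrite -(lebesgue_measure_shift s mBs) -(lebesgue_measure_shift (s - 1) mB0).
rewrite -measureU//; last first.
  by apply/seteqP; split => // u [[_ /=] + [_ /=]]; rewrite !in_itv/=; lra.
congr lebesgue_measure; rewrite -setIUr; congr (_ `&` _).
by apply/seteqP; split => u /=; rewrite !in_itv/=; [|case: (ltP u s) => us]; lra.
Qed.

Lemma haar_circle_itv (a b : R) : 0 <= a -> a <= b -> b <= 1 ->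
  haar_circle (@circle_val R @^-1` `[a, b[%classic) = (b - a)%:E :> \bar R.
Proof.
move=> a0 ab b1; rewrite /haar_circle image_circle_val setIidl.
  rewrite lebesgue_measure_itv/= lte_fin.
  by case: ltgtP ab => // -> _; rewrite subrr.
by move=> u /=; rewrite !in_itv/=; lra.
Qed.

Lemma haar_circle_zero : haar_circle [set x : circle R | circle_val x = 0] = 0%E.
Proof.
rewrite /haar_circle.
rewrite (_ : [set x | circle_val x = 0] = @circle_val R @^-1` [set 0])//.
rewrite image_circle_val setIidl ?lebesgue_measure_set1// => _ -> /=.
by rewrite in_itv/= lexx ltr01.
Qed.

End circle_rotation.

(** * Borel sets and Haar measure of a closed subgroup *)

Section closed_subgroup_theory.
Variables (R : realType) (d : nat) (S : set 'rV[R]_d).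
Local Notation G := (closed_subgroup S).
Local Notation gval := (@closed_subgroup_val _ S).

Lemma gvalD (x y : G) : gval (x + y) = gval x + gval y. Proof. by []. Qed.
Lemma gvalB (x y : G) : gval (x - y) = gval x - gval y. Proof. by []. Qed.
Lemma gval0 : gval 0 = 0. Proof. by []. Qed.
Lemma gval_inj : injective gval. Proof. exact: val_inj. Qed.

Lemma gval_continuous : continuous (gval : G -> 'rV[R]_d).
Proof. exact: initial_continuous. Qed.

Lemma measurable_open_subgroup (U : set G) : open U -> measurable U.
Proof. by move=> oU; exact: sub_sigma_algebra. Qed.

Lemma measurable_coord (j : 'I_d) :
  measurable_fun [set: G] (fun y => gval y ord0 j : measurableTypeR R).
Proof.
apply: (measurability (@RGenOInfty.G R)) => [|_ [_ [r ->] <-]].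
  exact: RGenOInfty.measurableE.
rewrite setTI; apply: measurable_open_subgroup.
apply: (@open_comp _ R (fun y : G => gval y ord0 j)); last exact: rray_open.
move=> y _; apply: (@continuous_comp _ _ _ gval (fun v : 'rV[R]_d => v ord0 j)).
  exact: gval_continuous.
exact: coord_continuous.
Qed.

(** An open set is the countable union of the rational boxes that it contains. *)
Lemma measurable_to_subgroup d' (T : measurableType d') (f : T -> G) :
  (forall j : 'I_d,
    measurable_fun setT (fun z => gval (f z) ord0 j : measurableTypeR R)) ->
  measurable_fun setT f.
Proof.
move=> mf; apply: (@measurability _ _ T G setT f (@open G)) => // _ [_ [V oV <-] <-].
rewrite setTI.
pose box (qn : 'rV[rat]_d * nat) : set T := [set z | forall j : 'I_d,
  `|gval (f z) ord0 j - ratr (qn.1 ord0 j)| < qn.2.+1%:R^-1].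
pose D := [set qn : 'rV[rat]_d * nat |
  forall v : 'rV[R]_d,
    (forall j : 'I_d, `|v ord0 j - ratr (qn.1 ord0 j)| < qn.2.+1%:R^-1) -> V v].
have -> : f @^-1` (gval @^-1` V) = \bigcup_qn (if qn \in D then box qn else set0).
  apply/seteqP; split => [z /= Vz|z [qn _]]; last first.
    by case: ifPn => // /set_mem Dq /= Bz; exact: Dq.
  have : nbhs (gval (f z)) V by exact: open_nbhs_nbhs.
  move=> /nbhs_ballP[e /= e0 eV].
  pose n := (Num.truncn (2 / e)).
  have ne : n.+1%:R^-1 < e / 2.
    by rewrite invf_plt ?posrE ?ltr0n ?divr_gt0// invf_div; exact: truncnS_gt.
  have n0 : 0 < n.+1%:R^-1 :> R by rewrite invr_gt0.
  have q_ex (j : 'I_d) : exists r : rat, `|gval (f z) ord0 j - ratr r| < n.+1%:R^-1.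
    have : gval (f z) ord0 j - n.+1%:R^-1 < gval (f z) ord0 j + n.+1%:R^-1.
      by rewrite ltrD2l gtrN.
    move=> /rat_in_itvoo[r].
    rewrite in_itv/= => h; exists r; move: h; rewrite ltr_norml.
    by move: (n.+1%:R^-1) => a; lra.
  have [q hq] := choice q_ex.
  exists (\row_j q j, n) => //; rewrite ifT.
    by move=> j /=; rewrite mxE.
  apply/mem_set => v /= hv; apply: eV; split => // i j; rewrite ord1.
  have := hv j; have := hq j; rewrite mxE /ball/= !ltr_norml.
  by move: (n.+1%:R^-1) ne => a; lra.
apply: countable_bigcupT_measurable; first exact: countableP.
move=> qn; case: ifPn => // _.
have -> : box qn = \bigcap_(j in [set: 'I_d])
    [set z | `|gval (f z) ord0 j - ratr (qn.1 ord0 j)| < qn.2.+1%:R^-1].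
  by apply/seteqP; split => [z h j _|z h j]; exact: h.
apply: fin_bigcap_measurable; first exact: finite_finset.
move=> j _.
have mh : measurable_fun [set: T]
    (fun z => `|gval (f z) ord0 j - ratr (qn.1 ord0 j)| : measurableTypeR R).
  apply: (measurableT_comp (@normr_measurable R setT)).
  by apply: (measurable_funB (mf j)); exact: measurable_cst.
have := mh measurableT `]-oo, (qn.2.+1%:R^-1 : R)[%classic (measurable_itv _).
rewrite setTI (_ : _ @^-1` _ =
  [set z | `|gval (f z) ord0 j - ratr (qn.1 ord0 j)| < qn.2.+1%:R^-1])//.
Qed.

Lemma measurable_addG : measurable_fun [set: G * G] (fun p => p.1 + p.2).
Proof.
apply: measurable_to_subgroup => j.
rewrite (_ : (fun _ => _) = (fun p : G * G => gval p.1 ord0 j + gval p.2 ord0 j)).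
  by apply: measurable_funD; apply: (measurableT_comp (measurable_coord j)).
by apply/funext => p; rewrite gvalD mxE.
Qed.

(** Open, hence stable under small translations, and bounded, hence of finite
    Haar measure. *)
Definition window (r : R) : set G := [set y | `|gval y| < r].

Lemma window_open r : open (window r).
Proof.
apply: (@open_comp _ R (fun y : G => `|gval y|) [set r' | r' < r]); last exact: open_lt.
move=> y _; apply: (@continuous_comp _ _ _ gval (fun v : 'rV[R]_d => `|v|)).
  exact: gval_continuous.
exact: norm_continuous.
Qed.

Lemma measurable_window r : measurable (window r).
Proof. by apply: measurable_open_subgroup; exact: window_open. Qed.

(** Cluster points exist in the ambient space, and belong to the subgroup because
    it is closed. *)
Lemma compact_closed_window r : compact [set y : G | `|gval y| <= r].
Proof.
have cK : compact (closed_generated S `&` [set v | `|v| <= r]).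
  apply: bounded_closed_compact.
    exists r; split; first exact: num_real.
    by move=> M rM v [_ /= /le_trans]; apply; exact: ltW.
  apply: closedI; first exact: closed_closure.
  rewrite (_ : [set _ | _] = Num.norm @^-1` [set x | x <= r])//.
  apply: (@preimage_closed _ _ _ _ _ (@closed_le _ r)) => v _.
  exact: norm_continuous.
move=> F FF Fr.
have pF : ProperFilter (gval @ F) by exact: fmap_proper_filter.
have FK : (gval @ F) (closed_generated S `&` [set v | `|v| <= r]).
  apply: (@filterS _ F _ [set y : G | `|gval y| <= r]) => // y yr; split => //=.
  exact/set_mem/(valP y).
have [v [[Sv vr] clv]] := cK _ pF FK.
exists (Sub v (mem_set Sv) : G); split => //.
move=> A B FA; rewrite nbhsE => -[_ [[V oV <-] Vv] VB].
have [] := clv (gval @` A) V.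
- by apply: (@filterS _ F _ A) => // y Ay; exists y.
- exact: open_nbhs_nbhs.
by move=> _ [[y Ay <-] Vy]; exists y; split => //; exact: VB.
Qed.

Lemma window_cover : \bigcup_n window n%:R = [set: G].
Proof.
apply/seteqP; split => // y _; exists (Num.truncn `|gval y|).+1 => //.
exact: truncnS_gt.
Qed.

Variable nu : {measure set G -> \bar R}.
Hypothesis haar : is_haar nu.

Lemma haar_window_lty r : (nu (window r) < +oo)%E.
Proof.
have [_ fin _ _] := haar; apply: le_lt_trans (fin _ (compact_closed_window (r := r))).
apply: le_measure; rewrite ?inE.
- exact: measurable_window.
- rewrite (_ : [set _ | _] = ~` [set y | r < `|gval y|]).
    apply: measurableC; apply: measurable_open_subgroup.
    apply: (@open_comp _ R (fun y : G => `|gval y|) [set r' | r < r']);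
      last exact: open_gt.
    move=> y _; apply: (@continuous_comp _ _ _ gval (fun v : 'rV[R]_d => `|v|)).
      exact: gval_continuous.
    exact: norm_continuous.
  by apply/seteqP; split => y /=; rewrite leNgt => /negP.
- by move=> y /ltW.
Qed.

Lemma haar_sigma_finite : sigma_finite setT nu.
Proof.
exists (fun n => window n%:R); first by rewrite window_cover.
by move=> n; split; [exact: measurable_window|exact: haar_window_lty].
Qed.

Lemma haar_translation (g : G) (A : set G) : measurable A ->
  nu ((fun y => y + g) @^-1` A) = nu A.
Proof.
have [tr _ _ _] := haar => mA; rewrite -(tr (- g) A mA); congr (nu _).
apply/seteqP; split => [y /= Ay|_ [y Ay <-]].
  by exists (y + g) => //; rewrite addrC addrK.
by rewrite /= addrC addNKr.
Qed.

Lemma haar_setT_gt0 : (0 < nu setT)%E.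
Proof. by have [_ _ pos _] := haar; apply: pos; [exact: openT|exists 0]. Qed.

End closed_subgroup_theory.

(** * Small displacements *)

Section small_displacement.
Local Open Scope ereal_scope.
Context d (Z : measurableType d) (R : realType) (m : {measure set Z -> \bar R}).
Variables (tau : nat -> Z -> Z) (N B B2 : set Z).
Hypothesis mtau : forall n, measurable_fun setT (tau n).
Hypothesis ptau : forall n A, measurable A -> m (tau n @^-1` A) = m A.
Hypotheses (mN : measurable N) (N0 : m N = 0).
Hypotheses (mB : measurable B) (mB2 : measurable B2) (B2_lty : m B2 < +oo).
Hypotheses (BB2 : B `<=` B2) (tauB : forall n z, B z -> B2 (tau n z)).

(** Openness with respect to the displacements [tau n], which may fail to be small
    on the null set [N]. *)
Definition eventually_stable (A : set Z) :=
  forall z, A z -> ~ N z -> \forall n \near \oo, A (tau n z).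

Hypothesis B2_stable : eventually_stable B2.

Let mpre n A : measurable A -> measurable (tau n @^-1` A).
Proof. by move=> mA; rewrite -[X in measurable X]setTI; exact: mtau. Qed.

Let D n (A : set Z) := (tau n @^-1` A `+` A) `&` B.

Let mY (A A' : set Z) : measurable A -> measurable A' -> measurable (A `+` A').
Proof. by move=> mA mA'; rewrite /setY; apply: measurableU; exact: measurableD. Qed.

Let mD n A : measurable A -> measurable (D n A).
Proof. by move=> mA; apply: measurableI => //; apply: mY => //; exact: mpre. Qed.

Let almost_invariant : set (set Z) := [set A | measurable A /\
  forall e : R, (0 < e)%R -> \forall n \near \oo, m (D n A) < e%:E].

Let le_D n (A A' F : set Z) : measurable A -> measurable A' -> measurable F ->
  D n A `<=` A' `|` F -> m (D n A) <= m A' + m F.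
Proof.
move=> mA mA' mF sub; apply: le_trans (measureU2 _ mA' mF).
by apply: le_measure; rewrite ?inE//; [exact: mD|exact: measurableU].
Qed.

(** Where [tau n] leaves [A] the displacements have to accumulate in [N]; as
    [tau n] preserves the finite measure of [A], what enters [A] weighs as much
    as what leaves it. *)
Let stable_finite (A : set Z) : measurable A -> eventually_stable A ->
  m A < +oo -> forall e : R, (0 < e)%R ->
  \forall n \near \oo, m (tau n @^-1` A `+` A) < e%:E.
Proof.
move=> mA sA Aoo e e0; pose E n := A `\` tau n @^-1` A.
have mE n : measurable (E n) by apply: measurableD => //; exact: mpre.
have Eoo : m (\bigcup_(k >= 0) E k) < +oo.
  apply: le_lt_trans Aoo; apply: le_measure; rewrite ?inE//.
    by apply: bigcup_measurable => n _; exact: mE.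
  by move=> z [n _ []].
have := lim_sup_set_cvg m E mE Eoo.
have -> : m (lim_sup_set E) = 0.
  apply/eqP; rewrite eq_le measure_ge0 andbT -N0.
  apply: le_measure; rewrite ?inE//.
    apply: bigcap_measurable; first by exists 0%N.
    by move=> k _; apply: bigcup_measurable => n _; exact: mE.
  move=> z Ez; apply: contrapT => Nz.
  have [n0 _ [Az _]] := Ez 0%N I.
  have [k _ kP] := sA z Az Nz.
  have [n /= kn [_]] := Ez k I; apply; exact: kP.
move=> /fine_cvgP[fE /cvgrPdist_lt/(_ (e / 2)%R)].
rewrite divr_gt0// => /(_ isT) small.
near=> n.
have En : m (E n) < (e / 2)%:E.
  apply: (@le_lt_trans _ _ (m (\bigcup_(k >= n) E k))).
    apply: le_measure; rewrite ?inE//; last by move=> z Ez; exists n => //=.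
    by apply: bigcup_measurable => j _; exact: mE.
  rewrite -[X in X < _]fineK; last by near: n.
  rewrite lte_fin; apply: le_lt_trans (ler_norm _) _.
  by rewrite -normrN -[(- _)%R]add0r; near: n.
have mAI : measurable (A `&` tau n @^-1` A) by apply: measurableI => //; exact: mpre.
have Aio : m (A `&` tau n @^-1` A) < +oo.
  by apply: le_lt_trans Aoo; apply: le_measure; rewrite ?inE.
have e1 : m (tau n @^-1` A `\` A) = m (E n).
  have mpA : measurable (tau n @^-1` A) by exact: mpre.
  have pAoo : m (tau n @^-1` A) < +oo by rewrite ptau.
  rewrite /E (measureD mpA mA pAoo) (measureD mA mpA Aoo) setIC.
  by congr (_ - _); exact: ptau.
rewrite /setY; apply: le_lt_trans (measureU2 _ _ _) _.
- by apply: measurableD => //; exact: mpre.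
- exact: mE.
have En2 : m (tau n @^-1` A `\` A) < (e / 2)%:E by rewrite e1.
rewrite [e]splitr EFinD; apply: lteD; [exact: En2|exact: En].
Unshelve. all: by end_near. Qed.

Let almost_invariant_stable (A : set Z) :
  measurable A -> eventually_stable A -> almost_invariant A.
Proof.
move=> mA sA; split => // e e0.
have mA2 : measurable (A `&` B2) by exact: measurableI.
have sA2 : eventually_stable (A `&` B2).
  by move=> z [Az B2z] Nz; near do split; [exact: sA|exact: B2_stable].
have A2oo : m (A `&` B2) < +oo.
  by apply: le_lt_trans B2_lty; apply: le_measure; rewrite ?inE.
have := stable_finite mA2 sA2 A2oo e0; apply: filterS => n; apply: le_lt_trans.
apply: le_measure; rewrite ?inE.
- exact: mD.
- by apply: mY => //; exact: mpre.
move=> z []; rewrite /setY => -[[? nA]|[? nA]] Bz; [left|right].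
  by split; [split => //; exact: tauB|case=> /nA].
by split; [split => //; exact: BB2|case=> /nA].
Unshelve. all: by end_near. Qed.

Let almost_invariantU (A A' : set Z) :
  almost_invariant A -> almost_invariant A' -> almost_invariant (A `|` A').
Proof.
move=> [mA hA] [mA' hA']; split; first exact: measurableU.
move=> e e0; have e2 : (0 < e / 2)%R by rewrite divr_gt0.
near=> n; apply: (@le_lt_trans _ _ (m (D n A) + m (D n A'))).
  apply: le_D; [exact: measurableU|exact: mD|exact: mD|].
  move=> z []; rewrite /D /setY => -[[[?|?] /not_orP[? ?]]|[[?|?] /not_orP[? ?]]] Bz;
    [left|right|left|right]; split => //; [left|left|right|right]; by split.
by rewrite [e]splitr EFinD; apply: lteD; near: n; [exact: hA|exact: hA'].
Unshelve. all: by end_near. Qed.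

Let almost_invariant_sigma_algebra : sigma_algebra setT almost_invariant.
Proof.
split.
- split => // e e0; near=> n.
  by rewrite /D preimage_set0 /setY setD0 set0U set0I measure0 lte_fin.
- move=> A [mA hA]; rewrite setTD; split; first exact: measurableC.
  move=> e /hA; apply: filterS => n; congr (m _ < _); rewrite /D; congr (_ `&` _).
  apply/seteqP; split => z /=;
    have [a|a] := pselect (A (tau n z)); have [b|b] := pselect (A z); tauto.
- move=> F hF.
  have mF i : measurable (F i) by exact: (hF i).1.
  pose A := \bigcup_i F i; pose Ak k := \big[setU/set0]_(i < k) F i.
  have mA : measurable A by exact: bigcupT_measurable.
  have hAk k : almost_invariant (Ak k).
    rewrite /Ak; elim: k => [|k IH]; last first.
      by rewrite big_ord_recr; exact: almost_invariantU.
    rewrite big_ord0; split => // e e0; near=> n.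
    by rewrite /D preimage_set0 /setY setD0 set0U set0I measure0 lte_fin.
  split => // e e0.
  pose E k := (A `\` Ak k) `&` B2.
  have mE k : measurable (E k).
    by apply: measurableI => //; apply: measurableD => //; exact: (hAk k).1.
  have : m (E k) @[k --> \oo] --> m (\bigcap_k E k).
    apply: nonincreasing_cvg_mu => //.
    - by apply: le_lt_trans B2_lty; apply: le_measure; rewrite ?inE// => z [].
    - exact: bigcapT_measurable.
    - move=> k l kl; apply/subsetPset; apply: setSI; apply: setDS.
      exact: subset_bigsetU.
  rewrite (_ : \bigcap_k E k = set0) ?measure0; last first.
    apply/seteqP; split => // z Ez; have [[[i _ Fi] _] _] := Ez 0%N I.
    have [[_ +] _] := Ez i.+1 I; apply.
    by rewrite /Ak -bigcup_mkord; exists i => /=.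
  move=> /fine_cvgP[fE /cvgrPdist_lt/(_ (e / 4)%R)].
  rewrite divr_gt0// => /(_ isT) small.
  have [k Ek] : exists k, m (E k) < (e / 4)%:E.
    have : \forall k \near \oo, m (E k) < (e / 4)%:E.
      near=> k; rewrite -[X in X < _]fineK; last by near: k.
      rewrite lte_fin; apply: le_lt_trans (ler_norm _) _.
      by rewrite -normrN -[(- _)%R]add0r; near: k.
    by move=> [k _ /(_ k (leqnn k)) ?]; exists k.
  have e2 : (0 < e / 2)%R by rewrite divr_gt0.
  have [mAk /(_ _ e2)] := hAk k; apply: filterS => n hn.
  have mpE : measurable (tau n @^-1` E k) by exact: mpre.
  apply: (@le_lt_trans _ _ (m (D n (Ak k)) + m (tau n @^-1` E k `|` E k))).
    apply: le_D => //; [exact: mD|exact: measurableU|].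
    move=> z []; rewrite /D /setY => -[] [/= Az nAz] Bz.
      have [tk|tk] := pselect (Ak k (tau n z)).
        left; split => //; left; split => // Akz; apply: nAz.
        by move: Akz; exact: bigsetU_bigcup.
      by right; left; split => //; exact: tauB.
    have [zk|zk] := pselect (Ak k z).
      left; split => //; right; split => // Akz; apply: nAz.
      by move: Akz; exact: bigsetU_bigcup.
    by right; right; split => //; exact: BB2.
  rewrite [e]splitr EFinD; apply: lteD => //.
  apply: le_lt_trans (measureU2 _ _ _) _ => //.
  have pE : m (tau n @^-1` E k) < (e / 4)%:E by rewrite ptau.
  rewrite (_ : (e / 2 = e / 4 + e / 4)%R); last by field.
  by rewrite EFinD; apply: lteD; [exact: pE|exact: Ek].
Unshelve. all: by end_near. Qed.

(** The sets of which little is moved inside [B] form a sigma-algebra. A countable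
    union is cut at a finite stage, the remainder being small in [B2]; the larger
    set [B2] is needed since [tau n] does not preserve [B]. *)
Lemma small_displacement (A : set Z) :
  <<s [set A | measurable A /\ eventually_stable A] >> A ->
  forall e : R, (0 < e)%R ->
  \forall n \near \oo, m ((tau n @^-1` A `+` A) `&` B) < e%:E.
Proof.
move=> sA; suff : almost_invariant A by case.
move: A sA; apply: smallest_sub; first exact: almost_invariant_sigma_algebra.
by move=> A [mA sA]; exact: almost_invariant_stable.
Qed.

End small_displacement.

(** * Skew maps *)

Section skew_maps.
Variables (R : realType) (d : nat) (S : set 'rV[R]_d).
Local Notation G := (closed_subgroup S).
Local Notation gval := (@closed_subgroup_val _ S).
Local Notation Z := (circle R * G)%type.

Definition skew_map (s : R) (psi : circle R -> G) (z : Z) : Z :=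
  (rotation s z.1, z.2 + psi z.1).

Lemma measurable_skew s psi : measurable_fun setT psi ->
  measurable_fun setT (skew_map s psi).
Proof.
move=> mpsi; apply: measurable_fun_pair.
  by apply: measurableT_comp (measurable_rotation s) _.
apply: (measurableT_comp (@measurable_addG R d S)
  (g := fun z : Z => (z.2, psi z.1))).
by apply: measurable_fun_pair => //; exact: measurableT_comp mpsi _.
Qed.

Lemma measurable_skew_preimage s psi (A : set Z) : measurable_fun setT psi ->
  measurable A -> measurable (skew_map s psi @^-1` A).
Proof.
by move=> mpsi mA; rewrite -[X in measurable X]setTI; exact: measurable_skew.
Qed.

Variable nu : {sigma_finite_measure set G -> \bar R}.
Hypothesis haar : is_haar nu.
Local Notation mu := (@haar_circle R).
Local Notation m := (mu \x nu)%E.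

Lemma integral_rotation s (f : circle R -> \bar R) :
  measurable_fun setT f -> (forall x, (0 <= f x)%E) ->
  (\int[mu]_x f (rotation s x) = \int[mu]_x f x)%E.
Proof.
move=> mf f0.
rewrite -[LHS](@ge0_integral_pushforward _ _ _ _ _ _
  (measurable_rotation s) mu setT f)//.
apply: eq_measure_integral => [|mr A mA _]; first exact: measurable_rotation.
exact: haar_circle_rotation.
Qed.

(** The section of the preimage at [x] is a translate of the section of [A] at
    [x + s]. *)
Lemma skew_preserves s psi (A : set Z) : measurable_fun setT psi ->
  measurable A -> m (skew_map s psi @^-1` A) = m A.
Proof.
move=> mpsi mA; rewrite /product_measure1.
rewrite -[RHS](integral_rotation s); last 2 first.
- exact: measurable_fun_xsection.
- by move=> x; exact: measure_ge0.
apply: eq_integral => x _ /=.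
rewrite -(haar_translation haar (psi x) (measurable_xsection _ mA)).
congr (nu _); apply/seteqP; split => y; rewrite /xsection/= !inE//.
Qed.

End skew_maps.

(** * Continuity of translations in measure *)

Section translation_continuity.
Variables (R : realType) (d : nat) (S : set 'rV[R]_d).
Local Notation G := (closed_subgroup S).
Local Notation gval := (@closed_subgroup_val _ S).
Local Notation Z := (circle R * G)%type.
Variable nu : {sigma_finite_measure set G -> \bar R}.
Hypothesis haar : is_haar nu.
Local Notation mu := (@haar_circle R).
Local Notation m := (mu \x nu)%E.

Definition slab (r : R) : set Z := setT `*` window (S := S) r.

Lemma measurable_slab r : measurable (slab r).
Proof. by apply: measurableX => //; exact: measurable_window. Qed.

Lemma slab_lty r : (m (slab r) < +oo)%E.
Proof.
rewrite product_measure1E//; last exact: measurable_window.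
by rewrite [X in (X * _)%E]probability_setT mul1e; exact: haar_window_lty.
Qed.

Lemma slab_cover : \bigcup_n slab n%:R = setT.
Proof.
apply/seteqP; split => // -[x y] _.
have : (\bigcup_n window (S := S) n%:R) y by rewrite window_cover.
by move=> [n _ yn]; exists n.
Qed.

Lemma slab_le r r' : r <= r' -> slab r `<=` slab r'.
Proof. by move=> rr' z [_ /= zr]; split => //; exact: lt_le_trans rr'. Qed.

Variables (s : nat -> R) (g : nat -> G).
Hypothesis s0 : forall e : R, 0 < e -> \forall n \near \oo, `|s n| < e.
Hypothesis g0 : forall e : R, 0 < e -> \forall n \near \oo, `|gval (g n)| < e.
Hypothesis g1 : forall n, `|gval (g n)| < 1.

Let tau n : Z -> Z := skew_map (s n) (cst (g n)).
Let N : set Z := [set z | circle_val z.1 = 0].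
Let stable := eventually_stable tau N.

Let zero_measurable : measurable [set x : circle R | circle_val x = 0].
Proof.
rewrite -[X in measurable X]setTI.
apply: (@measurable_circle_val R measurableT [set 0]).
exact: measurable_set1.
Qed.

Let NE : N = [set x | circle_val x = 0] `*` setT.
Proof. by apply/seteqP; split => z //= -[]. Qed.

Let mN : measurable N.
Proof. by rewrite NE; exact: measurableX. Qed.

Let N0 : m N = 0%E.
Proof. by rewrite NE product_measure1E// [X in (X * _)%E]haar_circle_zero mul0e. Qed.

(** A rotation by a small angle is a small translation of the representative in
    [[0, 1)], except near 0: this is why [N] is the fibre over 0. *)
Let stable_ray (r : R) : stable [set z | r < circle_val z.1].
Proof.
move=> [x y] /= rx /eqP x0; have /andP[xge0 x1] := circle_val_itv x.
have {x0}xgt0 : 0 < circle_val x by rewrite lt_neqAle eq_sym x0.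
pose e := Num.min (circle_val x - r) (Num.min (circle_val x) (1 - circle_val x)).
have e0 : 0 < e by rewrite !lt_min !subr_gt0 rx xgt0.
near=> n.
have : `|s n| < e by near: n; exact: s0.
rewrite /e !lt_min !ltr_norml => /andP[? /andP[? ?]].
by rewrite /= /rotation {1}/circle_val /= frac_id; lra.
Unshelve. all: by end_near. Qed.

Let stable_open (U : set G) : open U -> stable [set z | U z.2].
Proof.
move=> [V oV <-] [x y] /= Vy _.
have : nbhs (gval y) V by exact: open_nbhs_nbhs.
move=> /nbhs_ballP[e /= e0 eV]; near=> n.
have ne : `|gval (g n)| < e by near: n; exact: g0.
apply: eV; rewrite mx_norm_ball /ball_/= opprD addrA subrr add0r normrN.
exact: ne.
Unshelve. all: by end_near. Qed.

Let generated (A : set Z) : measurable A ->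
  <<s [set A | measurable A /\ stable A] >> A.
Proof.
set H := <<s _ >>; have sH : sigma_algebra setT H by exact: smallest_sigma_algebra.
apply: smallest_sub => // B [[P mP <-]|[U mU <-]].
- rewrite setTI; case: mP => C mC <-; rewrite setTI.
  suff : image_set_system setT (fun z : Z => circle_val z.1) H C.
    by rewrite /image_set_system/= setTI.
  have mC' : <<s @RGenOInfty.G R >> C.
    have := mC; rewrite -[X in X C]/(measurable : set (set (measurableTypeR R))).
    by rewrite RGenOInfty.measurableE.
  move: C {mC} mC'; apply: smallest_sub; first exact: sigma_algebra_image.
  move=> _ [r ->]; rewrite /image_set_system/= setTI; apply: sub_sigma_algebra.
  have -> : (fun z : Z => circle_val z.1) @^-1` `]r, +oo[ =
      [set z | r < circle_val z.1].
    by apply/seteqP; split => z /=; rewrite in_itv/= andbT.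
  split; last exact: stable_ray.
  rewrite -[X in measurable X]setTI.
  have mval : measurable_fun setT (fun z : Z => circle_val z.1 : measurableTypeR R).
    by apply: measurableT_comp => //; exact: measurable_circle_val.
  have := mval measurableT `]r, +oo[%classic (measurable_itv _).
  rewrite (_ : _ @^-1` _ = [set z : Z | r < circle_val z.1])//.
  by apply/seteqP; split => z /=; rewrite in_itv/= andbT.
- rewrite setTI; move: U mU.
  suff : measurable `<=` image_set_system setT (snd : Z -> G) H.
    by move=> h U /h; rewrite /image_set_system/= setTI.
  apply: smallest_sub; first exact: sigma_algebra_image.
  move=> U oU; rewrite /image_set_system/= setTI; apply: sub_sigma_algebra; split.
    rewrite -[X in measurable X]setTI.
    by apply: measurable_snd => //; exact: measurable_open_subgroup.
  exact: stable_open.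
Qed.

(** The preimages of the rays of the circle and of the open sets of the subgroup
    are eventually stable, and they generate the Borel sets of the product. *)
Lemma translation_small (A : set Z) (r e : R) : measurable A -> 0 < e ->
  \forall n \near \oo,
    (m ((skew_map (s n) (cst (g n)) @^-1` A `+` A) `&` slab r) < e%:E)%E.
Proof.
move=> mA e0.
apply: (@small_displacement _ _ _ m tau N (slab r) (slab (r + 1))) => //.
- by move=> n; apply: measurable_skew.
- by move=> n B mB; apply: skew_preserves.
- exact: measurable_slab.
- exact: measurable_slab.
- exact: slab_lty.
- by apply: slab_le; rewrite lerDl.
- move=> n [x y] [_ /= yr]; split => //=; rewrite /window/= gvalD.
  by apply: le_lt_trans (ler_normD _ _) _; exact: ltrD.
- move=> [x y] [_ wy] Nz.
  have := @stable_open _ (@window_open R d S (r + 1)) (x, y) wy Nz.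
  by apply: filterS => n h; split.
- exact: generated.
Qed.

End translation_continuity.

(** * Translations preserving a set *)

Section invariance.
Variables (R : realType) (d : nat) (S : set 'rV[R]_d).
Local Notation G := (closed_subgroup S).
Local Notation gval := (@closed_subgroup_val _ S).
Local Notation Z := (circle R * G)%type.
Variable nu : {sigma_finite_measure set G -> \bar R}.
Hypothesis haar : is_haar nu.
Local Notation mu := (@haar_circle R).
Local Notation m := (mu \x nu)%E.

Definition translate (s : R) (g : G) : Z -> Z := skew_map s (cst g).

Lemma translateD s s' g g' z :
  translate s g (translate s' g' z) = translate (s + s') (g + g') z.
Proof.
by rewrite /translate /skew_map/= rotationD (addrC s) (addrC g) addrA.
Qed.

Lemma null_sub (A B : set Z) : measurable A -> measurable B -> m B = 0%E ->
  A `<=` B -> m A = 0%E.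
Proof.
move=> mA mB B0 AB; apply/eqP; rewrite eq_le measure_ge0 andbT -B0.
by apply: le_measure; rewrite ?inE.
Qed.

Lemma measurable_setY (A B : set Z) :
  measurable A -> measurable B -> measurable (A `+` B).
Proof. by move=> mA mB; apply: measurableU; exact: measurableD. Qed.

Lemma product_null_setU (A B : set Z) : measurable A -> measurable B ->
  m A = 0%E -> m B = 0%E -> m (A `|` B) = 0%E.
Proof.
move=> mA mB A0 B0; apply/eqP; rewrite eq_le measure_ge0 andbT.
by apply: (@le_trans _ _ (m A + m B)%E); [exact: measureU2|rewrite A0 B0 adde0].
Qed.

Lemma null_slabs (A : set Z) : measurable A ->
  (forall n : nat, m (A `&` slab (S := S) n%:R) = 0%E) -> m A = 0%E.
Proof.
move=> mA h; have mF n : measurable (A `&` slab (S := S) n%:R).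
  by apply: measurableI => //; exact: measurable_slab.
rewrite -[A]setIT -(slab_cover S) setI_bigcupr.
apply/eqP; rewrite eq_le measure_ge0 andbT.
apply: le_trans (generalized_Boole_inequality m mF _) _.
  exact: bigcupT_measurable.
by rewrite eseries0// => n _ _; exact: h.
Qed.

Section one_set.
Variable A : set Z.
Hypothesis mA : measurable A.

Definition invariant_under (s : R) (g : G) : Prop :=
  m (translate s g @^-1` A `+` A) = 0%E.

Let mpre s g (B : set Z) : measurable B -> measurable (translate s g @^-1` B).
Proof. exact: measurable_skew_preimage. Qed.

Let mpreA s g : measurable (translate s g @^-1` A).
Proof. exact: mpre. Qed.

Let mYA s g : measurable (translate s g @^-1` A `+` A).
Proof. exact: measurable_setY. Qed.

Let pre_null s g (B : set Z) : measurable B -> m B = 0%E ->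
  m (translate s g @^-1` B) = 0%E.
Proof. by move=> mB B0; rewrite skew_preserves. Qed.

Lemma invariant_underD s s' g g' : invariant_under s g -> invariant_under s' g' ->
  invariant_under (s + s') (g + g').
Proof.
move=> h h'; apply: (@null_sub _ (translate s' g' @^-1` (translate s g @^-1` A `+` A)
    `|` (translate s' g' @^-1` A `+` A))) => //.
- by apply: measurableU => //; exact: mpre.
- by apply: product_null_setU => //; [exact: mpre|exact: pre_null].
move=> z; rewrite /= translateD.
by have [a|a] := pselect (A (translate s' g' z)); tauto.
Qed.

Lemma invariant_underN s g : invariant_under s g -> invariant_under (- s) (- g).
Proof.
move=> h; apply: (@null_sub _
  (translate (- s) (- g) @^-1` (translate s g @^-1` A `+` A))) => //.
- exact: mpre.
- exact: pre_null.
move=> z; rewrite /= translateD !subrr.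
have -> : translate 0 0 z = z.
  by case: z => x y; rewrite /translate /skew_map/= rotation0 addr0.
tauto.
Qed.

Lemma invariant_under_int (n : int) : invariant_under n%:~R 0.
Proof.
rewrite /invariant_under (_ : translate n%:~R 0 @^-1` A = A) ?setYK ?measure0//.
apply/seteqP; split => -[x y]; rewrite /translate /skew_map/= addr0 /rotation;
  by rewrite circle_classDint circle_valK.
Qed.

Lemma invariant_under0 : invariant_under 0 0.
Proof. exact: (invariant_under_int 0). Qed.

Lemma invariant_underMn s g n : invariant_under s g ->
  invariant_under (n%:R * s) (g *+ n).
Proof.
move=> h; elim: n => [|n IH]; first by rewrite mul0r; exact: invariant_under0.
by rewrite -natr1 mulrDl mul1r mulrSr; exact: invariant_underD.
Qed.

Lemma invariant_underMz s (n : int) : invariant_under s 0 ->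
  invariant_under (n%:~R * s) 0.
Proof.
move=> h; have nat_case (k : nat) : invariant_under (k%:R * s) 0.
  by have := invariant_underMn k h; rewrite mul0rn.
case: n => k; first exact: nat_case.
by rewrite NegzE mulrNz mulNr -oppr0; apply: invariant_underN; exact: nat_case.
Qed.

(** The translation by [(s, g)] is the translation by [(s_ n, g_ n)], which
    preserves [A], composed with a small translation, which moves little of [A]
    inside a slab. *)
Lemma invariant_under_lim s g (s_ : nat -> R) (g_ : nat -> G) :
  (forall e : R, 0 < e -> \forall n \near \oo, `|s - s_ n| < e) ->
  (forall e : R, 0 < e -> \forall n \near \oo, `|gval (g - g_ n)| < e) ->
  (forall n, `|gval (g - g_ n)| < 1) ->
  (forall n, invariant_under (s_ n) (g_ n)) -> invariant_under s g.
Proof.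
move=> hs hg hg1 inv; apply: null_slabs => // r.
set E := (_ `&` _).
have mE : measurable E by apply: measurableI => //; exact: measurable_slab.
suff small e : 0 < e -> (m E < e%:E)%E.
  apply/eqP; rewrite eq_le measure_ge0 andbT leNgt; apply/negP => mE0.
  have Eoo : (m E < +oo)%E by apply: lt_trans (small 1 _) _; rewrite ?ltry.
  have fE : m E \is a fin_num by rewrite ge0_fin_numE.
  have := small (fine (m E)); rewrite fineK// ltxx => h.
  by have := h (fine_gt0 (introT andP (conj mE0 Eoo))).
move=> e0.
have [n _ /(_ n (leqnn n)) small] :=
  translation_small haar hs hg hg1 r%:R mA e0.
pose F := translate (s - s_ n) (g - g_ n) @^-1` (translate (s_ n) (g_ n) @^-1` A `+` A).
have mF : measurable F by exact: mpre.
have F0 : m F = 0%E by exact: (pre_null _ _ (mYA _ _) (inv n)).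
pose I := (translate (s - s_ n) (g - g_ n) @^-1` A `+` A) `&` slab (S := S) r%:R.
have mI : measurable I.
  by apply: measurableI => //; exact: measurable_slab.
apply: le_lt_trans small.
apply: (@le_trans _ _ (m (F `|` I))).
  apply: le_measure; rewrite ?inE//; first exact: measurableU.
  move=> z [hz zr]; rewrite /F /I /= translateD !subrKC; move: hz => /=.
  have [a|a] := pselect (A (translate (s - s_ n) (g - g_ n) z)); tauto.
by rewrite -[X in (_ <= X)%E]add0e -F0; exact: measureU2.
Qed.

(** The numbers [q beta - p] given by the convergents are nonzero and tend to 0,
    so their integer multiples approach every real number. *)
Lemma invariant_under_irrational (beta : R) : irrational beta ->
  invariant_under beta 0 -> forall s, invariant_under s 0.
Proof.
move=> irr h s; pose q := cf_denom beta.
pose delta n := (q n.*2)%:R * beta - (cf_num beta n.*2)%:~R.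
have delta_small n : `|delta n| <= (2 ^ n)%:R^-1.
  have := cf_approx irr n.*2; have := cf_denom_exp irr 0 n.
  rewrite add0n muln1 => le2.
  have le2' : (2 ^ n <= q n.*2.+1)%N by rewrite (leq_trans le2)// cf_denom_leS.
  have d0 := normr_ge0 (delta n); rewrite -/(delta n) -/q => le1.
  rewrite -[_^-1]mul1r ler_pdivlMr ?ltr0n ?expn_gt0// mulrC.
  by apply: le_trans le1; rewrite ler_wpM2r// ler_nat.
have delta_neq0 n : delta n != 0.
  apply/eqP => /subr0_eq e; apply: (irr).
  exists ((cf_num beta n.*2)%:~R / (q n.*2)%:R) => //.
  rewrite fmorph_div/= ratr_int ratr_nat -e mulrC mulKf//.
  by rewrite pnatr_eq0 -lt0n; exact: cf_denom_gt0.
pose s_ n := (Num.floor (s / delta n))%:~R * delta n.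
have s_small n : `|s - s_ n| <= (2 ^ n)%:R^-1.
  apply: le_trans (delta_small n).
  have -> : s - s_ n = (s / delta n - (Num.floor (s / delta n))%:~R) * delta n.
    by rewrite /s_; field.
  rewrite normrM ler_piMl//; have /andP[] := Defs.frac_itv (s / delta n).
  by rewrite /Defs.frac => ? /ltW ?; rewrite ger0_norm.
apply: (@invariant_under_lim s 0 s_ (fun=> 0)).
- move=> e e0; near=> n; apply: le_lt_trans (s_small n) _.
  rewrite invf_plt ?posrE ?ltr0n ?expn_gt0//.
  apply: (@lt_trans _ _ n%:R); last by rewrite ltr_nat ltn_expl.
  apply: lt_le_trans (truncnS_gt _) _; rewrite ler_nat; near: n.
  by exists (Num.truncn e^-1).+1.
- by move=> e e0; near=> n; rewrite subr0 gval0 normr0.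
- by move=> n; rewrite subr0 gval0 normr0.
- move=> n; apply: invariant_underMz; rewrite -[0](addr0 0) /delta -mulrNz.
  apply: invariant_underD; last exact: invariant_under_int.
  by have := invariant_underMn (q n.*2) h; rewrite mul0rn.
Unshelve. all: by end_near. Qed.

Lemma invariant_under_closure :
  (forall g, S (gval g) -> invariant_under 0 g) -> forall g, invariant_under 0 g.
Proof.
move=> hS g.
pose H : set 'rV[R]_d := [set v | exists2 g : G, gval g = v & invariant_under 0 g].
have subH : smallest (@is_subgroup _) S `<=` H.
  apply: smallest_sub; last first.
    move=> v Sv; exists (Sub v (mem_set (sub_closed_generated Sv))) => //.
    exact: hS.
  split; first by exists 0 => //; exact: invariant_under0.
  move=> _ _ [x <- ix] [y <- iy]; exists (x - y) => //.
  rewrite -(subr0 0); apply: invariant_underD => //.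
  by rewrite oppr0 -(oppr0 R); apply: invariant_underN.
have approx n : exists g' : G, `|gval (g - g')| < n.+1%:R^-1 /\ invariant_under 0 g'.
  have clg : closed_generated S (gval g) by exact/set_mem/(valP g).
  have n0 : 0 < n.+1%:R^-1 :> R by rewrite invr_gt0.
  have [v [/subH[g' <- ig'] bv]] := clg _ (nbhsx_ballx (gval g) _ n0).
  by exists g'; split => //; move: bv; rewrite mx_norm_ball.
have [g_ hg] := choice approx.
apply: (@invariant_under_lim 0 g (fun=> 0) g_).
- by move=> e e0; near=> n; rewrite subr0 normr0.
- move=> e e0; near=> n; apply: lt_trans (hg n).1 _.
  rewrite invf_plt ?posrE ?ltr0n//; apply: lt_le_trans (truncnS_gt _) _.
  rewrite ler_nat; near: n.
  by exists (Num.truncn e^-1) => // n /=; rewrite ltnS.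
- move=> n; apply: lt_le_trans (hg n).1 _.
  by rewrite invf_le1 ?ltr0n// ler1n.
- by move=> n; exact: (hg n).2.
Unshelve. all: by end_near. Qed.

End one_set.
End invariance.

(** * Ergodicity of the group of all translations *)

Lemma product_measureC d1 d2 (T1 : measurableType d1) (T2 : measurableType d2)
    (R : realType) (m1 : {sigma_finite_measure set T1 -> \bar R})
    (m2 : {sigma_finite_measure set T2 -> \bar R}) (A : set (T1 * T2)) :
  measurable A -> (m1 \x m2)%E A = (m1 \x^ m2)%E A.
Proof.
by apply: product_measure_unique => B C mB mC; exact: product_measure2E.
Qed.

Section transitive_translations.
Variables (R : realType) (d : nat) (S : set 'rV[R]_d).
Local Notation G := (closed_subgroup S).
Local Notation gval := (@closed_subgroup_val _ S).
Local Notation Z := (circle R * G)%type.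
Variable nu : {sigma_finite_measure set G -> \bar R}.
Hypothesis haar : is_haar nu.
Local Notation mu := (@haar_circle R).
Local Notation m := (mu \x nu)%E.

Let op (p : Z * Z) : Z := translate (circle_val p.1.1) p.1.2 p.2.

Let opC z w : op (z, w) = op (w, z).
Proof. by rewrite /op /translate /skew_map/= /rotation addrC [w.2 + _]addrC. Qed.

Let measurable_op : measurable_fun setT op.
Proof.
apply: measurable_fun_pair.
  apply: (measurableT_comp (@measurable_circle_class R)).
  apply: measurable_funD; apply: (measurableT_comp (@measurable_circle_val R));
    by apply: measurableT_comp.
apply: (measurableT_comp (@measurable_addG R d S)
  (g := fun p : Z * Z => (p.2.2, p.1.2))).
by apply: measurable_fun_pair; apply: measurableT_comp.
Qed.

(** Fubini on the product of two copies of the group: the pairs [(z, w)] with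
    [z] outside [A] and [z + w] in [A] form a set of measure [m (~` A) * m A],
    all of whose sections in the other direction are null. *)
Lemma translation_ergodic (A : set Z) : measurable A ->
  (forall s g, invariant_under nu A s g) -> m A = 0%E \/ m (~` A) = 0%E.
Proof.
move=> mA inv; have mC : measurable (~` A) by exact: measurableC.
have sf : sigma_finite setT m.
  exists (fun n => slab (S := S) n%:R); first by rewrite slab_cover.
  by move=> n; split; [exact: measurable_slab|exact: slab_lty].
pose sf_mixin := Measure_isSigmaFinite.Build _ _ _ m sf.
pose ms : {sigma_finite_measure set Z -> \bar R} := HB.pack m sf_mixin.
pose Theta : set (Z * Z) := (~` A `*` setT) `&` op @^-1` A.
have mTheta : measurable Theta.
  apply: measurableI; first exact: measurableX.
  by rewrite -[X in measurable X]setTI; exact: measurable_op.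
have Theta0 : (m \x^ m)%E Theta = 0%E.
  rewrite /product_measure2 integral0_eq// => w _ /=.
  apply: (@null_sub _ _ _ _ _ (translate (circle_val w.1) w.2 @^-1` A `+` A)).
  - exact: measurable_ysection.
  - by apply: measurable_setY => //; exact: measurable_skew_preimage.
  - exact: inv.
  move=> z /ysectionP[[/= nAz _]]; rewrite opC => Az; left; split => //.
have : (m \x m)%E Theta = (m (~` A) * m A)%E.
  rewrite {1}/product_measure1.
  rewrite (eq_integral (fun z => (\1_(~` A) z)%:E * m A)%E).
    rewrite ge0_integralZr//; first by rewrite integral_indic// setIT.
    exact: measurableT_comp.
  move=> z _; rewrite indicE /=; have [/set_mem nAz|Az] := boolP (z \in ~` A).
    rewrite mul1e -(skew_preserves haar (circle_val z.1) (psi := cst z.2) _ mA)//.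
    congr (m _); apply/seteqP; split => w.
      by move=> /xsectionP[].
    by move=> Aw; apply/xsectionP; split.
  rewrite mul0e (_ : xsection Theta z = set0) ?measure0//.
  apply/seteqP; split => // w /xsectionP[[/= nAz _] _].
  by move: Az; rewrite (mem_set (nAz : (~` A) z)).
have -> : (m \x m)%E Theta = (m \x^ m)%E Theta.
  exact: (@product_measureC _ _ _ _ _ ms ms).
by rewrite Theta0 => /esym/eqP; rewrite mule_eq0 => /orP[/eqP|/eqP]; tauto.
Qed.

Lemma irrational_translation_ergodic (beta : R) (A : set Z) : measurable A ->
  irrational beta -> invariant_under nu A beta 0 ->
  (forall g, S (gval g) -> invariant_under nu A 0 g) ->
  m A = 0%E \/ m (~` A) = 0%E.
Proof.
move=> mA irr hb hS; apply: translation_ergodic => // s g.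
rewrite -[s]addr0 -[g]add0r; apply: invariant_underD => //.
  exact: invariant_under_irrational hb s.
exact: invariant_under_closure.
Qed.

(** The set [P `*` setT] is preserved by the translations of the fibres. *)
Lemma rotation_ergodic (alpha : R) (P : set (circle R)) : irrational alpha ->
  measurable P -> mu (rotation alpha @^-1` P `+` P) = 0%E ->
  mu P = 0%E \/ mu (~` P) = 0%E.
Proof.
move=> irr mP hP; have nu0 := haar_setT_gt0 haar.
have mrP : measurable (rotation alpha @^-1` P).
  by rewrite -[X in measurable X]setTI; exact: measurable_rotation.
have cancel_nu (B : set (circle R)) : measurable B ->
    m (B `*` setT) = 0%E <-> mu B = 0%E.
  move=> mB; rewrite product_measure1E//; split => [/eqP|B0]; last first.
    by rewrite [X in (X * _)%E]B0 mul0e.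
  rewrite mule_eq0 => /orP[/eqP//|/eqP nu_eq0].
  by have := lt_eqF nu0; rewrite eq_sym => /eqP; case; exact: nu_eq0.
have mPT : measurable (P `*` [set: G]) by exact: measurableX.
have [|| |] := @irrational_translation_ergodic alpha (P `*` setT) mPT irr.
- rewrite /invariant_under (_ : _ `+` _ = (rotation alpha @^-1` P `+` P) `*` setT).
    by apply/cancel_nu => //; apply: measurableU; exact: measurableD.
  by apply/seteqP; split => z; rewrite /translate /skew_map/=; tauto.
- move=> g _; rewrite /invariant_under (_ : _ `+` _ = set0) ?measure0//.
  by apply/seteqP; split => z //; rewrite /translate /skew_map/= rotation0; tauto.
- by move/cancel_nu => ?; left; auto.
- rewrite (_ : ~` (P `*` setT) = ~` P `*` setT).
    by move/cancel_nu => h; right; apply: h; exact: measurableC.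
  by apply/seteqP; split => z /=; tauto.
Qed.

End transitive_translations.

(** * Step functions *)

Lemma ltn_Zp (Q : nat) (k : 'Z_Q) : (1 < Q)%N -> (k < Q)%N.
Proof. by move=> Q_gt1; rewrite -[X in (_ < X)%N](Zp_cast Q_gt1). Qed.

Section step_functions.
Variables (R : realType) (d Q : nat) (Phi : 'Z_Q -> 'rV[R]_d).
Hypothesis Q_gt1 : (1 < Q)%N.

Let Q0 : 0 < Q%:R :> R. Proof. by rewrite ltr0n ltnW. Qed.

(** The index of the step that contains [y], defined on the real line so that
    orbits can be followed without reduction modulo 1. *)
Definition cell (y : R) : 'Z_Q := (Num.floor (Q%:R * y))%:~R.

Lemma Zp_char_int (n : int) : (n * Q%:Z)%:~R = 0 :> 'Z_Q.
Proof. by rewrite intrM -pmulrn pchar_Zp// mulr0. Qed.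

Lemma cellDint (y : R) (n : int) : cell (y + n%:~R) = cell y.
Proof.
rewrite /cell mulrDr (_ : Q%:R * n%:~R = (n * Q%:Z)%:~R); last first.
  by rewrite intrM mulrC.
by rewrite floorDint intrD Zp_char_int addr0.
Qed.

Lemma cell_frac (y : R) : cell (Defs.frac y) = cell y.
Proof. by rewrite /Defs.frac -mulrNz cellDint. Qed.

Lemma step_function_class (y : R) :
  step_function Phi (circle_class y) = Phi (cell y).
Proof.
rewrite -(cell_frac y) /step_function /cell /circle_val/=.
have /andP[y0 _] := Defs.frac_itv y.
have Qy : 0 <= Q%:R * Defs.frac y by rewrite mulr_ge0// ltW.
rewrite truncn_floor Qy; congr Phi.
by rewrite -[in RHS](gez0_abs (m := Num.floor _)) ?floor_ge0// -pmulrn.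
Qed.

(** Indicators written with floors turn Birkhoff sums into floor sums. *)
Lemma cell_indicator (y : R) (k : 'Z_Q) :
  (Num.floor (y - k%:R / Q%:R) - Num.floor (y - k%:R / Q%:R - 1 / Q%:R))%:~R
  = (cell y == k)%:R :> R.
Proof.
pose a := Num.floor (Q%:R * y); pose q := (a %/ Q)%Z; pose r := `|(a %% Q)%Z|%N.
have QZ : Q%:Z != 0 by rewrite eqz_nat -lt0n ltnW.
have rE : r%:Z = (a %% Q)%Z by rewrite gez0_abs// modz_ge0.
have rQ : (r < Q)%N by rewrite -ltz_nat rE ltz_pmod// ltz_nat ltnW.
have aE : a = q * Q%:Z + r%:Z by rewrite rE -divz_eq.
have cellE : cell y = r%:R by rewrite /cell -/a aE intrD Zp_char_int add0r -pmulrn.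
have -> : (cell y == k) = (r == k :> nat).
  by rewrite cellE -val_eqE/= val_Zp_nat// modn_small.
have /andP[a1 a2] := floor_itv (Q%:R * y).
rewrite -/a aE !intrD intrM mulr1z -!pmulrn in a1 a2.
have y1 : q%:~R + r%:R / Q%:R <= y.
  by rewrite -(ler_pM2l Q0) mulrDr mulrC mulrCA divff ?gt_eqF// mulr1.
have y2 : y < q%:~R + r%:R / Q%:R + 1 / Q%:R.
  rewrite -(ltr_pM2l Q0); apply: lt_le_trans a2 _.
  by rewrite le_eqVlt; apply/orP; left; apply/eqP; field; rewrite gt_eqF.
have r1 : r%:R / Q%:R + 1 / Q%:R <= 1 :> R.
  by rewrite -mulrDl ler_pdivrMr// mul1r natr1 ler_nat.
have k1 : k%:R / Q%:R + 1 / Q%:R <= 1 :> R.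
  by rewrite -mulrDl ler_pdivrMr// mul1r natr1 ler_nat ltn_Zp.
have r0 : 0 <= r%:R / Q%:R :> R by rewrite divr_ge0// ltW.
have k0 : 0 <= k%:R / Q%:R :> R by rewrite divr_ge0// ltW.
have Qi : 0 < 1 / Q%:R :> R by rewrite divr_gt0.
have gap m n : (m < n)%N -> m%:R / Q%:R + 1 / Q%:R <= n%:R / Q%:R :> R.
  by move=> mn; rewrite -mulrDl ler_pM2r ?invr_gt0// natr1 ler_nat.
have fl0 z : q%:~R <= z < (q + 1)%:~R -> Num.floor z = q by exact: floor_def.
have fl1 z : (q - 1)%:~R <= z < (q - 1 + 1)%:~R -> Num.floor z = q - 1.
  exact: floor_def.
have [rk|kr|rk] := ltngtP r k.
- have := gap _ _ rk => g; rewrite !fl1 ?subrr//; rewrite ?intrD ?mulrN1z ?mulr1z; lra.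
- have := gap _ _ kr => g; rewrite !fl0 ?subrr//; rewrite ?intrD ?mulr1z; lra.
- rewrite -rk in k0 k1 *; rewrite fl0; last by rewrite intrD mulr1z; lra.
  rewrite fl1; last by rewrite ?intrD ?mulrN1z ?mulr1z; lra.
  by rewrite opprB addrCA subrr addr0.
Qed.

Lemma step_function_sum (y : R) : Phi (cell y) =
  \sum_(k : 'Z_Q) (Num.floor (y - k%:R / Q%:R)
                   - Num.floor (y - k%:R / Q%:R - 1 / Q%:R))%:~R *: Phi k.
Proof.
under eq_bigr do rewrite cell_indicator.
rewrite (bigD1 (cell y))//= eqxx scale1r big1 ?addr0// => k.
by rewrite eq_sym => /negbTE ->; rewrite scale0r.
Qed.

Lemma centered_sum : centered (step_function Phi) -> \sum_(k : 'Z_Q) Phi k = 0.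
Proof.
move=> hc; apply/rowP => j; rewrite summxE mxE.
pose P (k : 'Z_Q) := @circle_val R @^-1` `[k%:R / Q%:R, k.+1%:R / Q%:R[%classic.
have mP k : measurable (P k).
  exists `[k%:R / Q%:R, k.+1%:R / Q%:R[%classic; first exact: measurable_itv.
  by rewrite setTI.
have muP k : haar_circle (P k) = (1 / Q%:R)%:E :> \bar R.
  rewrite haar_circle_itv ?divr_ge0 ?(ltW Q0)//.
  - by rewrite -natr1 mulrDl addrAC subrr add0r.
  - by rewrite ler_pM2r ?invr_gt0// ler_nat.
  - by rewrite ler_pdivrMr// mul1r ler_nat ltn_Zp.
have inP (x : circle R) k : (cell (circle_val x) == k)%:R = \1_(P k) x :> R.
  rewrite indicE; congr (_%:R); congr nat_of_bool.
  have /andP[x0 x1] := circle_val_itv x.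
  have fx : 0 <= Num.floor (Q%:R * circle_val x) by rewrite floor_ge0 mulr_ge0// ltW.
  pose r := `|Num.floor (Q%:R * circle_val x)|%N.
  have rE : Num.floor (Q%:R * circle_val x) = r%:Z by rewrite gez0_abs.
  have rQ : (r < Q)%N.
    by rewrite -ltz_nat -rE floor_lt_int -pmulrn gtr_pMr.
  rewrite /cell rE -pmulrn -val_eqE/= val_Zp_nat// modn_small//.
  have := floor_eq (Q%:R * circle_val x) k%:Z.
  rewrite rE eqz_nat => ->; rewrite -pmulrn intrD mulr1z -pmulrn natr1.
  apply/idP/idP => [h|/set_mem]; first apply/mem_set; rewrite /P/= in_itv/=.
    by rewrite ler_pdivrMr// ltr_pdivlMr// mulrC.
  by rewrite ler_pdivrMr// ltr_pdivlMr// mulrC.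
have := hc j.
rewrite (eq_integral (fun x =>
    \sum_(k : 'Z_Q) (Phi k ord0 j)%:E * (\1_(P k) x)%:E)%E); last first.
  move=> x _; rewrite -[x in LHS]circle_valK step_function_class step_function_sum.
  rewrite summxE -sumEFin; apply: eq_bigr => k _.
  by rewrite mxE cell_indicator inP mulrC EFinM.
rewrite integral_sum//; last first.
  by move=> k; apply: integrableZl => //; exact: integrable_indic.
rewrite (eq_bigr (fun k => (Phi k ord0 j / Q%:R)%:E)); last first.
  move=> k _; rewrite integralZl//; last exact: integrable_indic.
  by rewrite integral_indic// setIT [X in (_ * X)%E]muP -EFinM mul1r.
rewrite sumEFin => -[/eqP]; rewrite -mulr_suml mulf_eq0 invr_eq0 (gt_eqF Q0) orbF.
by move/eqP.
Qed.

End step_functions.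

(** * Birkhoff sums of the cocycle *)

Section cocycle_sums.
Variables (R : realType) (d Q : nat) (Phi : 'Z_Q -> 'rV[R]_d) (alpha : R).
Hypothesis Q_gt1 : (1 < Q)%N.
Local Notation S := (range (step_function Phi)).
Local Notation G := (closed_subgroup S).
Local Notation gval := (@closed_subgroup_val _ S).
Local Notation c := (cocycle (step_function Phi)).

Let Q0 : 0 < Q%:R :> R. Proof. by rewrite ltr0n ltnW. Qed.

Definition cocycle_sum (t : nat) (x : circle R) : G :=
  \sum_(j < t) c (rotation (j%:R * alpha) x).

Lemma gval_cocycle (y : R) : gval (c (circle_class y)) = Phi (cell Q y).
Proof. exact: step_function_class. Qed.

Lemma gval_cocycle_sum t (y : R) :
  gval (cocycle_sum t (circle_class y)) = \sum_(j < t) Phi (cell Q (y + j%:R * alpha)).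
Proof.
rewrite /cocycle_sum; elim: t => [|t IH]; first by rewrite !big_ord0.
by rewrite !big_ord_recr/= gvalD IH rotation_class gval_cocycle.
Qed.

Lemma measurable_cocycle : measurable_fun setT c.
Proof.
apply: measurable_to_subgroup => j.
rewrite (_ : (fun _ => _) = fun x : circle R => \sum_(k : 'Z_Q)
    ((Num.floor (circle_val x - k%:R / Q%:R))%:~R -
     (Num.floor (circle_val x - k%:R / Q%:R - 1 / Q%:R))%:~R) * Phi k ord0 j).
  have mfl (e : R) : measurable_fun setT
      (fun x : circle R => (Num.floor (circle_val x - e))%:~R : R).
    apply: (measurableT_comp (@measurable_floor R)).
    by apply: measurable_funB => //; exact: measurable_circle_val.
  apply: measurable_sum => k; apply: measurable_funM => //.
  apply: measurable_funB => //.
  by under eq_fun do rewrite -addrA -opprD; exact: mfl.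
apply/funext => x; rewrite -[x in LHS]circle_valK gval_cocycle step_function_sum//.
by rewrite summxE; apply: eq_bigr => k _; rewrite mxE intrB.
Qed.

Lemma measurable_cocycle_sum t : measurable_fun setT (cocycle_sum t).
Proof.
elim: t => [|t IH].
  rewrite (_ : cocycle_sum 0 = cst 0)//.
  by apply/funext => x; rewrite /cocycle_sum big_ord0.
rewrite (_ : cocycle_sum t.+1 =
    fun x => cocycle_sum t x + c (rotation (t%:R * alpha) x)); last first.
  by apply/funext => x; rewrite /cocycle_sum big_ord_recr.
apply: (measurableT_comp (@measurable_addG R d S)
  (g := fun x => (cocycle_sum t x, c (rotation (t%:R * alpha) x)))).
apply: measurable_fun_pair => //.
by apply: (measurableT_comp measurable_cocycle); exact: measurable_rotation.
Qed.

Lemma iter_skew_map t z :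
  iter t (skew_map alpha c) z = skew_map (t%:R * alpha) (cocycle_sum t) z.
Proof.
elim: t => [|t IH].
  by case: z => x y; rewrite /skew_map/= mul0r rotation0 /cocycle_sum big_ord0 addr0.
rewrite iterS IH /skew_map/= rotationD -natr1 mulrDl mul1r; congr (_, _).
by rewrite /cocycle_sum big_ord_recr/= addrA.
Qed.

(** The cocycle sums at a good time are bounded integer combinations of the
    values, after subtracting the multiple [t / Q] of their vanishing sum. *)
Lemma cocycle_sum_bound t h x : centered (step_function Phi) ->
  good_time alpha Q t h ->
  `|gval (cocycle_sum t x)| <= 2 * \sum_(k : 'Z_Q) `|Phi k|.
Proof.
move=> /(centered_sum Q_gt1) sum0 [_ _ _ _ count].
rewrite -(circle_valK x) gval_cocycle_sum; move: (circle_val x) => y.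
have -> : \sum_(j < t) Phi (cell Q (y + j%:R * alpha)) =
    \sum_(k : 'Z_Q) ((floor_sum alpha t (y - k%:R / Q%:R)
      - floor_sum alpha t (y - k%:R / Q%:R - 1 / Q%:R))%:~R - t%:R / Q%:R) *: Phi k.
  under eq_bigr do rewrite step_function_sum//.
  rewrite exchange_big/=.
  under [in RHS]eq_bigr do rewrite scalerBl.
  rewrite big_split/= sumrN -scaler_sumr sum0 scaler0 subr0.
  apply: eq_bigr => k _; rewrite -scaler_suml; congr (_ *: _).
  rewrite /floor_sum -sumrB rmorph_sum/=; apply: eq_bigr => j _.
  congr (_%:~R). congr (_ - _); congr (Num.floor _); ring.
apply: le_trans (ler_norm_sum _ _ _) _; rewrite mulr_sumr.
by apply: ler_sum => k _; rewrite normrZ ler_wpM2r.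
Qed.

(** Moving by [h] the [j]-th point of the orbit of [y] carries it across a
    multiple of [1 / Q]. *)
Let jump (y h : R) (j : nat) : bool :=
  Num.floor (Q%:R * (y + j%:R * alpha)) < Num.floor (Q%:R * (y + j%:R * alpha + h)).

(** Two jumps would put [Q (j' - j) alpha] at distance less than [Q h] from an
    integer. *)
Let jump_uniq (y h : R) (t j j' : nat) : good_time alpha Q t h ->
  (j < t)%N -> (j' < t)%N -> jump y h j -> jump y h j' -> j = j'.
Proof.
move=> [_ h0 _ sep _]; wlog jj' : j j' / (j <= j')%N.
  move=> wl jt jt' hj hj'; have [le|le] := leP j j'; first exact: wl.
  by apply/esym; apply: wl => //; exact: ltnW.
move=> jt jt'; rewrite /jump !floor_lt_int.
set a := Num.floor _ => a1; set a' := Num.floor _ => a1'.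
have a2 := floor_le (Q%:R * (y + j%:R * alpha + h)); rewrite -/a in a2.
have a2' := floor_le (Q%:R * (y + j'%:R * alpha + h)); rewrite -/a' in a2'.
move: jj'; rewrite leq_eqVlt => /orP[/eqP//|jj'].
have := sep (j' - j)%N (a' - a); rewrite subn_gt0 jj' (leq_ltn_trans (leq_subr _ _))//.
move=> /(_ isT); rewrite leNgt => /negP; case.
rewrite natrM natrB ?(ltnW jj')// intrB ltr_norml.
rewrite !mulrDr in a1 a1' a2 a2'.
rewrite (_ : Q%:R * (j'%:R - j%:R) * alpha =
    Q%:R * (j'%:R * alpha) - Q%:R * (j%:R * alpha)); last by ring.
by apply/andP; split; lra.
Qed.

(** The points whose [j]-th iterate lies at distance at most [h] to the left of the
    discontinuity [k / Q]. *)
Definition jump_set (h : R) (k : 'Z_Q) (j : nat) : set (circle R) :=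
  rotation (j%:R * alpha + h) @^-1`
    (@circle_val R @^-1` `[k%:R / Q%:R, k%:R / Q%:R + h[%classic).

Lemma measurable_jump_set h k j : measurable (jump_set h k j).
Proof.
rewrite -[X in measurable X]setTI; apply: measurable_rotation => //.
exists `[k%:R / Q%:R, k%:R / Q%:R + h[%classic; first exact: measurable_itv.
by rewrite setTI.
Qed.

Let k_h_le1 (k : 'Z_Q) (h : R) : h <= 1 / Q%:R -> k%:R / Q%:R + h <= 1.
Proof.
move=> h1; apply: (@le_trans _ _ (k%:R / Q%:R + 1 / Q%:R)); first by rewrite lerD2l.
by rewrite -mulrDl ler_pdivrMr// mul1r natr1 ler_nat ltn_Zp.
Qed.

Lemma haar_jump_set h k j : 0 < h -> h <= 1 / Q%:R ->
  haar_circle (jump_set h k j) = h%:E :> \bar R.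
Proof.
move=> h0 h1; rewrite haar_circle_rotation; last first.
  exists `[k%:R / Q%:R, k%:R / Q%:R + h[%classic; first exact: measurable_itv.
  by rewrite setTI.
rewrite haar_circle_itv ?divr_ge0 ?(ltW Q0)//; last exact: k_h_le1.
  by rewrite addrAC subrr add0r.
by rewrite lerDl ltW.
Qed.

Let jump_setP h k j (y : R) : 0 < h -> h <= 1 / Q%:R ->
  jump_set h k j (circle_class y) ->
  [/\ jump y h j, cell Q (y + j%:R * alpha + h) = k &
      cell Q (y + j%:R * alpha) = k - 1].
Proof.
move=> h0 h1; rewrite /jump_set/= rotation_class/= in_itv/= /circle_val/= addrA.
set z := y + _ + h => /andP[]; rewrite /Defs.frac; set n := Num.floor z => k1 k2.
have e1 : Num.floor (Q%:R * z) = n * Q%:Z + k%:Z.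
  have zn : Q%:R * z = (n * Q%:Z)%:~R + Q%:R * (z - n%:~R).
    by rewrite intrM -pmulrn; ring.
  apply: floor_def; rewrite zn -[_ + k%:Z + 1]addrA !(intrD _ (n * Q%:Z)).
  rewrite lerD2l ltrD2l intrD -!pmulrn.
  rewrite ler_pdivrMr// mulrC in k1; rewrite k1/= mulrC -ltr_pdivlMr//.
  apply: lt_le_trans k2 _; rewrite mulrDl lerD2l//.
have e2 : Num.floor (Q%:R * (y + j%:R * alpha)) = n * Q%:Z + k%:Z - 1.
  apply: floor_def; have := floor_itv (Q%:R * z); rewrite e1.
  have Qh : Q%:R * h <= 1 by rewrite mulrC -ler_pdivlMr.
  have zh : Q%:R * (y + j%:R * alpha) = Q%:R * z - Q%:R * h by rewrite /z; ring.
  have zk : Q%:R * z < (n * Q%:Z + k%:Z)%:~R + Q%:R * h.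
    rewrite intrD intrM -!pmulrn; move: k2; rewrite -(ltr_pM2l Q0) => k2.
    rewrite -subr_gt0 in k2; rewrite -subr_gt0; apply: lt_le_trans k2 _.
    by rewrite le_eqVlt; apply/orP; left; apply/eqP; field; rewrite gt_eqF.
  rewrite zh !intrD !mulrN1z mulr1z in zk *; lra.
split.
- by rewrite /jump -/z e1 e2; lia.
- by rewrite /cell -/z e1 intrD Zp_char_int// add0r -pmulrn natr_Zp.
- by rewrite /cell e2 intrB intrD Zp_char_int// add0r -pmulrn natr_Zp mulr1z.
Qed.

(** By [jump_uniq] the other terms of the sum do not change. *)
Lemma cocycle_sum_jump t h k j x : good_time alpha Q t h -> (j < t)%N ->
  jump_set h k j x ->
  gval (cocycle_sum t (rotation h x)) =
  gval (cocycle_sum t x) + (Phi k - Phi (k - 1)).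
Proof.
move=> gt jt; have [_ h0 h1 _ _] := gt.
rewrite -(circle_valK x); move: (circle_val x) => y jx.
have [jy c1 c2] := jump_setP h0 h1 jx.
rewrite rotation_class !gval_cocycle_sum.
rewrite (bigD1 (Ordinal jt))//= [in RHS](bigD1 (Ordinal jt))//=.
rewrite (addrAC y h) c1 c2 [RHS]addrAC [X in _ = X + _]addrC subrK.
congr (_ + _); apply: eq_bigr => i ij; congr (Phi _%:~R).
apply/eqP; rewrite eq_le (le_floor (x := Q%:R * (y + i%:R * alpha))) ?andbT; last first.
  by rewrite ler_pM2l// addrAC lerDl ltW.
rewrite leNgt; apply/negP => ji; move: ij; rewrite -val_eqE/= => /eqP; apply.
apply: (@jump_uniq y h t i j gt (ltn_ord i) jt _ jy).
by rewrite /jump (addrAC y _ h).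
Qed.

Lemma haar_jump_union t h k : good_time alpha Q t h ->
  haar_circle (\big[setU/set0]_(j < t) jump_set h k j) = (t%:R * h)%:E :> \bar R.
Proof.
move=> gt; have [_ h0 h1 _ _] := gt.
rewrite (@measure_bigsetU_ord _ _ _ (@haar_circle R) t xpredT
  (fun j => jump_set h k j)); last 2 first.
- by move=> j; exact: measurable_jump_set.
- move=> i j _ _ [x]; rewrite -(circle_valK x); move: (circle_val x) => y.
  move=> [/(jump_setP h0 h1)[hi _ _] /(jump_setP h0 h1)[hj _ _]].
  exact/val_inj/(jump_uniq gt (ltn_ord i) (ltn_ord j) hi hj).
rewrite (eq_bigr (fun=> h%:E)); last by move=> j _; exact: haar_jump_set.
by rewrite sumEFin sumr_const card_ord mulr_natl.
Qed.

End cocycle_sums.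

(** * Conservativity and jumps of the skew product *)

Lemma not_setY (X : Type) (A B : set X) x : ~ (A `+` B) x -> (A x <-> B x).
Proof. by move=> n; split => h; apply: contrapT => h'; apply: n; [left|right]. Qed.

Section skew_product_dynamics.
Variables (R : realType) (d Q : nat) (Phi : 'Z_Q -> 'rV[R]_d) (alpha : R).
Hypothesis Q_gt1 : (1 < Q)%N.
Local Notation S := (range (step_function Phi)).
Local Notation G := (closed_subgroup S).
Local Notation Z := (circle R * G)%type.
Local Notation gval := (@closed_subgroup_val _ S).
Local Notation c := (cocycle (step_function Phi)).
Variable nu : {sigma_finite_measure set G -> \bar R}.
Hypothesis haar : is_haar nu.
Hypothesis Phi_centered : centered (step_function Phi).
Local Notation mu := (@haar_circle R).
Local Notation m := (mu \x nu)%E.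
Local Notation T := (skew_map alpha c).

Let Tn t : Z -> Z := skew_map (t%:R * alpha) (cocycle_sum Phi alpha t).
Let M := 2 * \sum_(k : 'Z_Q) `|Phi k|.

Let M_ge0 : 0 <= M. Proof. by rewrite mulr_ge0// sumr_ge0. Qed.

Let iterT t : iter t T = Tn t.
Proof. by apply/funext => z; exact: iter_skew_map. Qed.

Let mTpre t (A : set Z) : measurable A -> measurable (Tn t @^-1` A).
Proof. by apply: measurable_skew_preimage; exact: measurable_cocycle_sum. Qed.

Let pTpre t (A : set Z) : measurable A -> m (Tn t @^-1` A) = m A.
Proof. by apply: skew_preserves => //; exact: measurable_cocycle_sum. Qed.

Let mtr s g (A : set Z) : measurable A -> measurable (translate s g @^-1` A).
Proof. exact: measurable_skew_preimage. Qed.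

Let ptr s g (A : set Z) : measurable A -> m (translate s g @^-1` A) = m A.
Proof. exact: skew_preserves. Qed.

Lemma skew_product_measure_preserving : measure_preserving m T.
Proof.
split; first by apply: measurable_skew; exact: measurable_cocycle.
by move=> A mA; apply: skew_preserves => //; exact: measurable_cocycle.
Qed.

Let Tn_slab t h r z : good_time alpha Q t h -> slab (S := S) r (Tn t z) ->
  slab (S := S) (r + M) z.
Proof.
move=> gt [_ /= wr]; split => //=; rewrite /window/=.
have -> : gval z.2 = gval (z.2 + cocycle_sum Phi alpha t z.1)
    - gval (cocycle_sum Phi alpha t z.1) by rewrite gvalD addrK.
apply: le_lt_trans (ler_normB _ _) _; apply: ltr_leD => //.
exact: (cocycle_sum_bound _ _ _ gt).
Qed.

Let slab_Tn t h r z : good_time alpha Q t h -> slab (S := S) r z ->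
  slab (S := S) (r + M) (Tn t z).
Proof.
move=> gt [_ /= wr]; split => //=; rewrite /window/= gvalD.
apply: le_lt_trans (ler_normD _ _) _; apply: ltr_leD => //.
exact: (cocycle_sum_bound _ _ _ gt).
Qed.

Hypothesis irr : irrational alpha.
Variable c0 : R.
Hypothesis c0_gt0 : 0 < c0.
Hypothesis good : forall N, exists2 t, (N <= t)%N & good_time alpha Q t (c0 / t%:R).

(** Along good times the iterates of a wandering set of finite measure would be
    infinitely many disjoint sets of equal measure in a slab of finite measure. *)
Lemma skew_product_conservative : conservative m T.
Proof.
move=> W mW wW; apply: null_slabs => // r; set V := W `&` _.
have mV : measurable V by apply: measurableI => //; exact: measurable_slab.
have /choice[t_ ht] : forall n, exists t,
    (n <= t)%N /\ good_time alpha Q t (c0 / t%:R).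
  by move=> n; have [t] := good n; exists t.
pose u := fix u n := match n with 0 => t_ 0%N | n'.+1 => t_ (u n').+1 end.
have u_incr n : (u n < u n.+1)%N by rewrite /=; have [] := ht (u n).+1.
have u_mono : {mono u : i j / (i <= j)%N}.
  by apply: leq_mono; apply: homo_ltn => //; exact: ltn_trans.
have u_good n : good_time alpha Q (u n) (c0 / (u n)%:R).
  by case: n => [|n]; [exact: (ht 0%N).2|exact: (ht (u n).+1).2].
apply/eqP; rewrite eq_le measure_ge0 andbT leNgt; apply/negP => V0.
have Vfin : m V \is a fin_num.
  rewrite ge0_fin_numE//; apply: le_lt_trans (slab_lty (S := S) haar r%:R).
  by apply: le_measure; rewrite ?inE//; [exact: measurable_slab|exact: subIsetr].
have bound n : ((n%:R * fine (m V))%:E <= m (slab (S := S) (r%:R + M)))%E.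
  have -> : ((n%:R * fine (m V))%:E = \sum_(i < n) m (Tn (u i) @^-1` V))%E.
    rewrite (eq_bigr (fun=> (fine (m V))%:E)); last first.
      by move=> i _; rewrite pTpre// fineK.
    by rewrite sumEFin sumr_const card_ord mulr_natl.
  rewrite -(@measure_bigsetU_ord _ _ _ m n xpredT (fun i => Tn (u i) @^-1` V)).
  - apply: le_measure; rewrite ?inE.
    + by apply: bigsetU_measurable => i _; exact: mTpre.
    + exact: measurable_slab.
    + move=> z; rewrite -bigcup_seq => -[i _ [_ Vz]].
      exact: (Tn_slab (u_good i)).
  - by move=> i; exact: mTpre.
  - move=> i j _ _ [z [[Wi _] [Wj _]]]; apply/val_inj.
    have := @wW (u i) (u j) I I; rewrite !iterT => uij.
    have /eqP : u i = u j by apply: uij; exists z.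
    by rewrite eqn_leq !u_mono -eqn_leq => /eqP.
have sfin : m (slab (S := S) (r%:R + M)) \is a fin_num.
  by rewrite ge0_fin_numE ?measure_ge0//; exact: slab_lty.
have v0 : 0 < fine (m V) by rewrite fine_gt0// V0 -ge0_fin_numE.
pose n := (Num.truncn (fine (m (slab (S := S) (r%:R + M))) / fine (m V))).+1.
have := bound n; rewrite -(fineK sfin) lee_fin leNgt => /negP; apply.
by rewrite -ltr_pdivrMr// truncnS_gt.
Qed.

Section invariant_set.
Variable A : set Z.
Hypotheses (mA : measurable A) (A_inv : m (T @^-1` A `+` A) = 0%E).

Let mTA : measurable (T @^-1` A).
Proof. by apply: measurable_skew_preimage => //; exact: measurable_cocycle. Qed.

Let Tn_inv t : m (Tn t @^-1` A `+` A) = 0%E.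
Proof.
elim: t => [|t IH].
  by rewrite -iterT (_ : iter 0 T @^-1` A = A)// setYK measure0.
have mB : measurable (Tn t @^-1` (T @^-1` A `+` A)).
  by apply: mTpre; exact: measurable_setY.
have mC : measurable (Tn t @^-1` A `+` A) by apply: measurable_setY => //; exact: mTpre.
apply: (@null_sub _ _ _ _ _ (Tn t @^-1` (T @^-1` A `+` A) `|` (Tn t @^-1` A `+` A))).
- by apply: measurable_setY => //; exact: mTpre.
- exact: measurableU.
- apply: product_null_setU => //; rewrite pTpre//; exact: measurable_setY.
move=> z; rewrite -!iterT /=.
by have [a|a] := pselect (A (iter t T z)); tauto.
Qed.

Section jump_direction.
Variables (k : 'Z_Q) (D : G).
Hypothesis gvalD_jump : gval D = Phi k - Phi (k - 1).

Let A_D : set Z := translate 0 D @^-1` A `+` A.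

Let mA_D : measurable A_D. Proof. by apply: measurable_setY => //; exact: mtr. Qed.

Let translate_Tn t z : translate 0 D (Tn t z) = Tn t (translate 0 D z).
Proof. by rewrite /translate /Tn /skew_map/= !rotation0 addrAC. Qed.

Let A_D_Tn t : m (Tn t @^-1` A_D `+` A_D) = 0%E.
Proof.
have mC : measurable (Tn t @^-1` A `+` A) by apply: measurable_setY => //; exact: mTpre.
apply: (@null_sub _ _ _ _ _
  (translate 0 D @^-1` (Tn t @^-1` A `+` A) `|` (Tn t @^-1` A `+` A))).
- by apply: measurable_setY => //; exact: mTpre.
- by apply: measurableU => //; exact: mtr.
- by apply: product_null_setU => //; [exact: mtr|rewrite ptr].
move=> z; rewrite /A_D /= translate_Tn.
by have [a1|a1] := pselect (A (Tn t (translate 0 D z)));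
  have [a2|a2] := pselect (A (Tn t z));
  have [a3|a3] := pselect (A (translate 0 D z));
  have [a4|a4] := pselect (A z); tauto.
Qed.

Let E h : set Z := translate h 0 @^-1` A `+` A.

Let mE h : measurable (E h). Proof. by apply: measurable_setY => //; exact: mtr. Qed.

Let W t : set (circle R) := \big[setU/set0]_(j < t) jump_set alpha (c0 / t%:R) k j.

Let mW t : measurable (W t).
Proof. by apply: bigsetU_measurable => j _; exact: measurable_jump_set. Qed.

(** Crossing a jump, [Tn t] carries the small rotation [translate h 0] to the
    translation by [D] (up to [translate h 0] itself): the four points [z],
    [translate h 0 z] and their images under [Tn t] tie membership of [Tn t z]
    in [A] to that of its translate by [D]. *)
Let jump_transfer t h z : good_time alpha Q t h ->
  (\big[setU/set0]_(j < t) jump_set alpha h k j) z.1 ->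
  Tn t (translate h 0 z) = translate h D (Tn t z).
Proof.
move=> gt; rewrite -bigcup_seq => -[j _ zj].
rewrite /Tn /translate /skew_map/= !rotationD addr0 [h + _]addrC; congr (_, _).
apply: gval_inj; rewrite !gvalD (cocycle_sum_jump Phi Q_gt1 gt (ltn_ord j) zj) addrA.
by rewrite gvalD_jump.
Qed.

(** Outside the null set [N], a point of [A_D] to the left of a jump is moved in
    or out of [A] by [translate h 0], or else the translate by [D] of its image
    under [Tn t] is. *)
Let jump_estimate t r : good_time alpha Q t (c0 / t%:R) ->
  (m (A_D `&` (W t `*` window (S := S) r)) <=
   m (E (c0 / t%:R) `&` slab (S := S) (r + (M + `|gval D|)))
   + m (E (c0 / t%:R) `&` slab (S := S) (r + (M + `|gval D|))))%E.
Proof.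
set h := c0 / t%:R => gt; set r' := r + _.
have mWr : measurable (W t `*` window (S := S) r).
  by apply: measurableX => //; exact: measurable_window.
have mEr : measurable (E h `&` slab (S := S) r').
  by apply: measurableI => //; exact: measurable_slab.
pose N0 := Tn t @^-1` A_D `+` A_D.
pose N1 := Tn t @^-1` A `+` A.
have mN0 : measurable N0 by apply: measurable_setY => //; exact: mTpre.
have mN1 : measurable N1 by apply: measurable_setY => //; exact: mTpre.
pose N := N0 `|` (N1 `|` translate h 0 @^-1` N1).
have mN : measurable N.
  by apply: measurableU => //; apply: measurableU => //; exact: mtr.
have N_null : m N = 0%E.
  apply: product_null_setU => //;
    [by apply: measurableU => //; exact: mtr|exact: A_D_Tn|].
  apply: product_null_setU => //; [exact: mtr|exact: Tn_inv|].
  by rewrite ptr//; exact: Tn_inv.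
pose F := Tn t @^-1` (translate 0 D @^-1` (E h `&` slab (S := S) r')).
have mF : measurable F by apply: mTpre; exact: mtr.
have pF : m F = m (E h `&` slab (S := S) r').
  by apply: etrans (ptr 0 D mEr); apply: pTpre; exact: mtr.
have sub : A_D `&` (W t `*` window (S := S) r) `<=`
    N `|` ((E h `&` slab (S := S) r') `|` F).
  move=> z [ADz [/= Wz wz]].
  have zr : slab (S := S) r z by split.
  have jt := jump_transfer gt Wz.
  have e0 : translate h D (Tn t z) = translate h 0 (translate 0 D (Tn t z)).
    by rewrite translateD addr0 add0r.
  have zr' : slab (S := S) r' z by apply: slab_le zr; rewrite lerDl addr_ge0.
  have zF : slab (S := S) r' (translate 0 D (Tn t z)).
    have [_ /= w] := slab_Tn gt zr; split => //; rewrite /window/= gvalD.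
    by apply: le_lt_trans (ler_normD _ _) _; rewrite /r' addrA ltr_leD.
  have [n0|n0] := pselect (N0 z); first by left; left.
  have [n1|n1] := pselect (N1 z); first by left; right; left.
  have [n2|n2] := pselect (N1 (translate h 0 z)); first by left; right; right.
  right; have [Ez|nEz] := pselect (E h z); first by left.
  right; split => //.
  have ADw : A_D (Tn t z) by exact/(not_setY n0).
  have h1 : A (Tn t z) <-> A z by exact: not_setY n1.
  have h2 : A (translate h 0 (translate 0 D (Tn t z))) <-> A (translate h 0 z).
    by have := not_setY n2; rewrite /preimage/= jt e0.
  have h3 : A (translate h 0 z) <-> A z by exact: not_setY nEz.
  case: ADw => -[/= a1 a2]; [right|left]; split => //=.
    by move=> /h2/h3/h1.
  by apply/h2/h3/h1.
apply: (@le_trans _ _ (m (N `|` ((E h `&` slab (S := S) r') `|` F)))).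
  apply: le_measure; rewrite ?inE//; first exact: measurableI.
  by apply: measurableU => //; exact: measurableU.
apply: (@le_trans _ _ (m N + m ((E h `&` slab (S := S) r') `|` F))%E).
  by apply: measureU2 => //; exact: measurableU.
by rewrite N_null add0e -[X in (_ <= _ + X)%E]pF; exact: measureU2.
Qed.

Let c0_small e : 0 < e -> exists2 t, good_time alpha Q t (c0 / t%:R) &
  c0 / t%:R < e.
Proof.
move=> e0; have [t Nt gt] := good (Num.truncn (c0 / e)).+1; exists t => //.
have [t0 _ _ _ _] := gt.
rewrite ltr_pdivrMr ?ltr0n// mulrC -ltr_pdivrMr//.
by apply: lt_le_trans (truncnS_gt _) _; rewrite ler_nat.
Qed.

Let jump_small r e : 0 < e -> exists2 t, good_time alpha Q t (c0 / t%:R) &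
  (m (A_D `&` (W t `*` window (S := S) r)) < e%:E)%E.
Proof.
move=> e0; have /choice[t_ ht] : forall n, exists t,
    good_time alpha Q t (c0 / t%:R) /\ c0 / t%:R < n.+1%:R^-1.
  by move=> n; have [|t] := @c0_small n.+1%:R^-1; [rewrite invr_gt0|exists t].
have e2 : 0 < e / 2 by rewrite divr_gt0.
have g0 : forall eps : R, 0 < eps -> \forall n \near \oo, `|gval 0| < eps.
  by move=> eta eta0; exists 0%N => // n _ /=; rewrite gval0 normr0.
have g1 (n : nat) : `|gval 0| < 1 by rewrite gval0 normr0.
have s0 : forall eps : R, 0 < eps -> \forall n \near \oo, `|c0 / (t_ n)%:R| < eps.
  move=> eps eps0; exists (Num.truncn eps^-1) => // n /= epsn.
  rewrite ger0_norm; last by rewrite divr_ge0// ltW.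
  apply: lt_trans (ht n).2 _; rewrite invf_plt ?posrE ?ltr0n//.
  by apply: lt_le_trans (truncnS_gt _) _; rewrite ler_nat.
have := translation_small (g := fun=> 0) haar s0 g0 g1 (r + (M + `|gval D|)) mA e2.
move=> [n _ /(_ n (leqnn n)) small].
exists (t_ n); first exact: (ht n).1.
apply: le_lt_trans (jump_estimate r (ht n).1) _.
by rewrite [e]splitr EFinD; exact: lteD.
Qed.


Let sec (B : set Z) (x : circle R) : \bar R := nu (xsection B x).

Let sec_ge0 B x : (0 <= sec B x)%E. Proof. exact: measure_ge0. Qed.

Let msec B : measurable B -> measurable_fun setT (sec B).
Proof. exact: measurable_fun_xsection. Qed.

Let mpos B (e : \bar R) : measurable B -> measurable [set x | (e < sec B x)%E].
Proof.
move=> mB; rewrite -[X in measurable X]setTI.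
by apply: emeasurable_fun_o_infty => //; exact: msec.
Qed.

Let null_sections B : measurable B -> m B = 0%E -> mu [set x | (0 < sec B x)%E] = 0%E.
Proof.
move=> mB B0; apply: measure_negligible; first exact: mpos.
have : ae_eq mu setT (sec B) (cst 0%E).
  apply/(ae_eq_integral_abs mu measurableT (msec mB)).
  rewrite -[RHS]B0; apply: eq_integral => x _; exact: gee0_abs.
move=> [N [mN N0 sub]]; exists N; split => // x /= xpos; apply: sub => /= h.
by move: xpos; rewrite h// ltxx.
Qed.

Let P : set (circle R) := [set x | (0 < sec A_D x)%E].

Let sec_T x : sec (T @^-1` A_D) x = sec A_D (rotation alpha x).
Proof.
rewrite /sec -(haar_translation haar (c x)
  (measurable_xsection (rotation alpha x) mA_D)).
by congr (nu _); apply/seteqP; split => y; rewrite /xsection/= !inE.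
Qed.

(** [A_D] is [T]-invariant up to a null set, and [T] carries the section at [x] to
    a translate of the section at [x + alpha]. *)
Let P_inv : mu (rotation alpha @^-1` P `+` P) = 0%E.
Proof.
have T1 : T = Tn 1.
  by rewrite -iterT.
have mTA_D : measurable (T @^-1` A_D) by rewrite T1; exact: mTpre.
pose B := T @^-1` A_D `+` A_D.
have mB : measurable B by exact: measurable_setY.
have B0 : m B = 0%E by rewrite /B T1; exact: A_D_Tn.
have mP : measurable P by exact: mpos.
have mrP : measurable (rotation alpha @^-1` P).
  by rewrite -[X in measurable X]setTI; exact: measurable_rotation.
have le_sec (B1 B2 : set Z) x : measurable B1 -> measurable B2 -> B1 `<=` B2 `|` B ->
    (sec B1 x <= sec B2 x + sec B x)%E.
  move=> mB1 mB2 sub.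
  apply: (@le_trans _ _ (nu (xsection B2 x `|` xsection B x))).
    apply: le_measure; rewrite ?inE.
    - exact: measurable_xsection.
    - by apply: measurableU; exact: measurable_xsection.
    - by move=> y /xsectionP/sub[?|?]; [left|right]; exact/xsectionP.
  by apply: measureU2; exact: measurable_xsection.
apply/eqP; rewrite eq_le measure_ge0 andbT -(null_sections mB B0).
apply: le_measure; rewrite ?inE.
- by apply: measurableU; exact: measurableD.
- exact: mpos.
move=> x /= [[]|[]]; rewrite /P/= -sec_T => h1 /negP; rewrite -leNgt => h2.
- have h3 : sec A_D x = 0%E by apply/eqP; rewrite eq_le h2 sec_ge0.
  apply: lt_le_trans h1 _; rewrite -[X in (_ <= X)%E]add0e -h3.
  apply: le_sec => // z Tz; have [az|az] := pselect (A_D z); first by left.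
  by right; left.
- have h3 : sec (T @^-1` A_D) x = 0%E by apply/eqP; rewrite eq_le h2 sec_ge0.
  apply: lt_le_trans h1 _; rewrite -[X in (_ <= X)%E]add0e -h3.
  apply: le_sec => // z Tz; have [az|az] := pselect ((T @^-1` A_D) z); first by left.
  by right; right.
Qed.

Let P_null : mu P = 0%E -> m A_D = 0%E.
Proof.
move=> P0; have mP : measurable P by exact: mpos.
have mPT : measurable (P `*` [set: G]) by exact: measurableX.
have mB : measurable (A_D `&` (~` P `*` setT)).
  by apply: measurableI => //; apply: measurableX => //; exact: measurableC.
apply: (@null_sub _ _ _ _ _ (P `*` [set: G] `|` (A_D `&` (~` P `*` setT)))) => //.
- exact: measurableU.
- apply: product_null_setU => //.
    by rewrite product_measure1E// [X in (X * _)%E]P0 mul0e.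
  rewrite /product_measure1 integral0_eq// => x _ /=; apply/eqP.
  rewrite eq_le measure_ge0 andbT; have [Px|Px] := pselect (P x).
    rewrite (_ : xsection _ x = set0) ?measure0//.
    by apply/seteqP; split => // y /xsectionP[_ [/= +]]; tauto.
  apply: (@le_trans _ _ (sec A_D x)); last by rewrite leNgt; exact/negP.
  apply: le_measure; rewrite ?inE; try exact: measurable_xsection.
  by move=> y /xsectionP[? _]; exact/xsectionP.
- by move=> z Az; have [Pz|Pz] := pselect (P z.1); [left|right].
Qed.

(** If almost every section of [A_D] had positive measure, then for some [n] the
    points of [Pn n], whose sections are bounded from below inside a fixed window,
    would have measure more than [1 - c0 / 2]. They would fill half of the jump
    set [W t], of measure [c0] at every good time [t], against [jump_small]. *)
Let P_not_conull : mu (~` P) = 0%E -> False.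
Proof.
move=> P1; have mP : measurable P by exact: mpos.
have mslab r := measurable_slab (S := S) r.
pose B n : set Z := A_D `&` slab (S := S) n%:R.
have mB n : measurable (B n) by exact: measurableI.
pose Pn n := [set x | ((n.+1%:R^-1)%:E < sec (B n) x)%E].
have mPn n : measurable (Pn n) by exact: mpos.
have B_nd m' n x : (m' <= n)%N -> xsection (B m') x `<=` xsection (B n) x.
  move=> mn y /xsectionP[? h]; apply/xsectionP; split => //.
  by apply: slab_le h; rewrite ler_nat.
have Pn_nd : nondecreasing_seq Pn.
  move=> m' n mn; apply/subsetPset => x /= h; rewrite /Pn/=.
  apply: (@le_lt_trans _ _ (m'.+1%:R^-1)%:E).
    by rewrite lee_fin lef_pV2 ?posrE// ler_nat.
  apply: lt_le_trans h _; apply: le_measure; rewrite ?inE; try exact: measurable_xsection.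
  exact: B_nd.
have Pn_cover : P `<=` \bigcup_n Pn n.
  move=> x Px.
  have cv : sec (B n) x @[n --> \oo] --> sec A_D x.
    rewrite /sec (_ : xsection A_D x = \bigcup_n xsection (B n) x).
      apply: nondecreasing_cvg_mu.
      - by move=> n; exact: measurable_xsection.
      - by apply: bigcupT_measurable => n; exact: measurable_xsection.
      - by move=> m' n mn; apply/subsetPset; exact: B_nd.
    rewrite -xsection_bigcup; congr (xsection _ x).
    by rewrite /B -setI_bigcupr slab_cover setIT.
  have [n0 n0x] : exists n, (0 < sec (B n) x)%E.
    apply/not_existsP => h; move: Px; rewrite /P/= -(cvg_lim _ cv)//.
    rewrite (_ : (fun n => _) = cst 0%E) ?lim_cst ?ltxx//.
    apply/funext => n /=; apply/eqP; rewrite eq_le sec_ge0 andbT leNgt.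
    exact/negP/h.
  have [e e0 ex] : exists2 e : R, 0 < e & (e%:E < sec (B n0) x)%E.
    case: (sec (B n0) x) n0x => [r|_|//].
      by rewrite lte_fin => r0; exists (r / 2); [rewrite divr_gt0|rewrite lte_fin; lra].
    by exists 1; rewrite ?ltry.
  pose n := maxn n0 (Num.truncn e^-1).
  exists n => //; rewrite /Pn/=.
  apply: (@lt_le_trans _ _ (sec (B n0) x)).
    apply: lt_trans ex; rewrite lte_fin invf_plt ?posrE//.
    by apply: lt_le_trans (truncnS_gt _) _; rewrite ler_nat ltnS leq_maxr.
  apply: le_measure; rewrite ?inE; try exact: measurable_xsection.
  by apply: B_nd; exact: leq_maxl.
have Pn1 : mu (Pn n) @[n --> \oo] --> 1%E.
  have -> : 1%E = mu (\bigcup_n Pn n) :> \bar R.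
    apply/eqP; rewrite eq_le probability_le1 ?andbT; last exact: bigcupT_measurable.
    rewrite -(@probability_setT _ _ _ mu) -(setUv P).
    apply: (@le_trans _ _ (mu P + mu (~` P))%E).
      by apply: measureU2 => //; exact: measurableC.
    rewrite P1 adde0; apply: le_measure; rewrite ?inE//.
    exact: bigcupT_measurable.
  by apply: nondecreasing_cvg_mu => //; exact: bigcupT_measurable.
have [n Pn_big] : exists n, ((1 - c0 / 2)%:E < mu (Pn n))%E.
  apply/not_existsP => h.
  have : (1 <= (1 - c0 / 2)%:E :> \bar R)%E.
    rewrite -(cvg_lim _ Pn1)//; apply: lime_le; first by apply/cvg_ex; exists 1%E.
    by apply: nearW => n; rewrite leNgt; exact/negP/h.
  by rewrite lee_fin => le1; have := c0_gt0; lra.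
have e0 : 0 < n.+1%:R^-1 * (c0 / 2) by rewrite mulr_gt0 ?invr_gt0// divr_gt0.
have [t gt small] := jump_small n%:R e0.
have muW : mu (W t) = c0%:E.
  rewrite (haar_jump_union Q_gt1 k gt); congr (_%:E).
  by have [t0 _ _ _ _] := gt; rewrite mulrC divfK// pnatr_eq0 -lt0n.
have mWP : measurable (W t `&` Pn n) by exact: measurableI.
have WP_big : ((c0 / 2)%:E <= mu (W t `&` Pn n))%E.
  have fin X : measurable X -> mu X \is a fin_num by move=> mX; exact: fin_num_measure.
  have fI := fin _ mWP; have fP := fin _ (mPn n).
  have mD : measurable (W t `\` Pn n) by exact: measurableD.
  have e1 : (c0%:E = mu (W t `\` Pn n) + mu (W t `&` Pn n))%E.
    by rewrite -muW; exact: measureDI.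
  have e2 : (mu (W t `\` Pn n) + mu (Pn n) <= 1)%E.
    rewrite -(@measureU _ _ _ mu)//; last first.
      by apply/seteqP; split => // x [[_ +] /=]; tauto.
    by apply: probability_le1; exact: measurableU.
  move: e1 e2 Pn_big; rewrite -(fineK fI) -(fineK fP) -(fineK (fin _ mD)).
  rewrite -!EFinD !lee_fin lte_fin => -[e1]; lra.
move: small; rewrite ltNge => /negP; apply.
rewrite EFinM; apply: (@le_trans _ _ ((n.+1%:R^-1)%:E * mu (W t `&` Pn n))%E).
  by apply: lee_wpmul2l; rewrite ?lee_fin.
rewrite -[X in mu X]setIT -integral_indic// -ge0_integralZl//; last first.
  exact: measurableT_comp.
have mC : measurable (A_D `&` (W t `*` window (S := S) n%:R)).
  by apply: measurableI => //; apply: measurableX => //; exact: measurable_window.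
apply: ge0_le_integral => //.
- by apply: measurable_funeM; exact: measurableT_comp.
- exact: (msec mC).
move=> x _; rewrite indicE /=; have [/set_mem[Wx Px]|_] := boolP (x \in _); last first.
  by rewrite mule0.
rewrite mule1; apply: ltW; apply: lt_le_trans Px _.
apply: le_measure; rewrite ?inE; try exact: measurable_xsection.
by move=> y /xsectionP[? [_ /= wy]]; apply/xsectionP.
Qed.

Lemma jump_invariant : invariant_under nu A 0 D.
Proof.
have mP : measurable P by exact: mpos.
have [|/P_not_conull//] := rotation_ergodic haar irr mP P_inv.
exact: P_null.
Qed.

End jump_direction.
End invariant_set.

End skew_product_dynamics.

(** * Ergodicity of the skew product *)

Section skew_product_ergodic.
Variables (R : realType) (d Q : nat) (Phi : 'Z_Q -> 'rV[R]_d) (alpha : R).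
Hypothesis Q_gt1 : (1 < Q)%N.
Local Notation S := (range (step_function Phi)).
Local Notation G := (closed_subgroup S).
Local Notation Z := (circle R * G)%type.
Local Notation gval := (@closed_subgroup_val _ S).
Local Notation c := (cocycle (step_function Phi)).
Variable nu : {sigma_finite_measure set G -> \bar R}.
Hypothesis haar : is_haar nu.
Hypothesis Phi_centered : centered (step_function Phi).
Local Notation mu := (@haar_circle R).
Local Notation m := (mu \x nu)%E.
Local Notation T := (skew_map alpha c).
Hypothesis irr : irrational alpha.
Variable c0 : R.
Hypothesis c0_gt0 : 0 < c0.
Hypothesis good : forall N, exists2 t, (N <= t)%N & good_time alpha Q t (c0 / t%:R).

Let value (k : 'Z_Q) : G := c (circle_class (k%:R / Q%:R)).

Let gval_value k : gval (value k) = Phi k.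
Proof.
rewrite /value gval_cocycle// /cell mulrC divfK; last by rewrite pnatr_eq0 -lt0n ltnW.
by rewrite [Num.floor _](intrKfloor k%:Z) -pmulrn natr_Zp.
Qed.

Let cocycle_value x : c x = value (cell Q (circle_val x)).
Proof. by apply: gval_inj; rewrite gval_value -{1}(circle_valK x) gval_cocycle. Qed.

Let sum_value : \sum_k value k = 0.
Proof.
apply: gval_inj; rewrite gval0 -(centered_sum Q_gt1 Phi_centered).
rewrite (big_morph gval (@gvalD _ _ _) (@gval0 _ _ _)).
by apply: eq_bigr => k _; exact: gval_value.
Qed.

Section invariant_set.
Variable A : set Z.
Hypotheses (mA : measurable A) (A_inv : m (T @^-1` A `+` A) = 0%E).
Local Notation inv := (invariant_under nu A).

Let inv_step k : inv 0 (value k - value (k - 1)).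
Proof.
apply: (jump_invariant Q_gt1 haar Phi_centered irr c0_gt0 good mA A_inv (k := k)).
by rewrite gvalB !gval_value.
Qed.

Let inv_difference k : inv 0 (value k - value 0).
Proof.
rewrite -(natr_Zp k); elim: (k : nat) => [|n IH].
  by rewrite subrr; exact: invariant_under0.
rewrite -(subrK (value n%:R) (value n.+1%:R)) -addrA -[0](addr0 0).
apply: invariant_underD => //.
by have := inv_step n.+1%:R; rewrite -{2}natr1 addrK.
Qed.

(** Up to the translations by differences of values, [T] is the translation
    by [(alpha, Phi 0)]. *)
Let inv_value0 : inv alpha (value 0).
Proof.
have mT : measurable (T @^-1` A `+` A).
  apply: measurable_setY => //; apply: measurable_skew_preimage => //.
  exact: measurable_cocycle.
pose F (k : 'Z_Q) : set Z :=
  T @^-1` (translate 0 (value 0 - value k) @^-1` A `+` A).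
have mtr g : measurable (translate 0 g @^-1` A).
  exact: measurable_skew_preimage.
have mF k : measurable (F k).
  apply: measurable_skew_preimage; first exact: measurable_cocycle.
  exact: measurable_setY.
have F0 k : m (F k) = 0%E.
  rewrite skew_preserves//; [|exact: measurable_cocycle|exact: measurable_setY].
  by rewrite -opprB -[0]oppr0; apply: invariant_underN.
have UF : measurable (\big[setU/set0]_k F k) /\ m (\big[setU/set0]_k F k) = 0%E.
  elim/big_ind: _ => [|B C [mB B0] [mC C0]|k _]; last by split.
    by split; [exact: measurable0|exact: measure0].
  by split; [exact: measurableU|exact: product_null_setU].
apply: (@null_sub _ _ _ _ _ (\big[setU/set0]_k F k `|` (T @^-1` A `+` A))).
- by apply: measurable_setY => //; exact: measurable_skew_preimage.
- by apply: measurableU => //; exact: UF.1.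
- by apply: product_null_setU => //; [exact: UF.1|exact: UF.2].
move=> z hz; pose k := cell Q (circle_val z.1).
have e : translate alpha (value 0) z = translate 0 (value 0 - value k) (T z).
  rewrite /translate /skew_map/= rotation0; congr (_, _).
  by rewrite cocycle_value -/k -addrA [value k + _]addrC subrK.
have [b|nb] := pselect ((T @^-1` A `+` A) z); first by right.
have n := not_setY nb.
left; rewrite -bigcup_seq; exists k; first by rewrite /= mem_index_enum.
by case: hz; rewrite /preimage/= e => -[a1 a2]; [left|right]; split => //=;
  [move=> /n|exact/n].
Qed.

(** As the values sum to 0, [Q] times [value 0] is minus the sum of the differences
    [value k - value 0]. *)
Let inv_rotation : inv (Q%:R * alpha) 0.
Proof.
have h1 : inv (Q%:R * alpha) (value 0 *+ Q) by exact: invariant_underMn.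
have h2 : inv 0 (\sum_k (value k - value 0)).
  elim/big_ind: _ => [|x y hx hy|k _]; last exact: inv_difference.
    exact: invariant_under0.
  by rewrite -[0](addr0 0); exact: invariant_underD.
have e : \sum_k (value k - value 0) = - (value 0 *+ Q).
  by rewrite sumrB sum_value sub0r sumr_const card_ord Zp_cast.
by have := invariant_underD haar mA h1 h2; rewrite e subrr addr0.
Qed.

Let irr_Q : irrational (Q%:R * alpha).
Proof.
move=> [r _ rE]; apply: (irr); exists (r / Q%:R) => //.
rewrite fmorph_div/= ratr_nat rE mulrC mulKf// pnatr_eq0 -lt0n.
exact: ltnW.
Qed.

Lemma skew_invariant_trivial : m A = 0%E \/ m (~` A) = 0%E.
Proof.
apply: (irrational_translation_ergodic haar mA irr_Q inv_rotation) => g [x _ gx].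
have v0 : inv 0 (value 0).
  have hs := invariant_under_irrational haar mA irr_Q inv_rotation (- alpha).
  by have := invariant_underD haar mA inv_value0 hs; rewrite subrr addr0.
have -> : g = (value (cell Q (circle_val x)) - value 0) + value 0.
  by rewrite subrK -cocycle_value; apply: gval_inj; rewrite -gx.
by rewrite -[0](addr0 0); apply: invariant_underD => //; exact: inv_difference.
Qed.

End invariant_set.

Lemma skew_product_ergodic : ergodic m T.
Proof. by move=> A mA A_inv; exact: skew_invariant_trivial. Qed.

End skew_product_ergodic.

(** A measure bundled with a proof of sigma-finiteness, as product measures require. *)
Section sigma_finite_packing.
Context d (X : measurableType d) (R : realType) (mu : {measure set X -> \bar R}).
Hypothesis mu_sigma_finite : sigma_finite setT mu.

Let mu_copy : set X -> \bar R := mu.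
HB.instance Definition _ := Measure.on mu_copy.
HB.instance Definition _ :=
  Measure_isSigmaFinite.Build d X R mu_copy mu_sigma_finite.

Definition pack_sigma_finite : {sigma_finite_measure set X -> \bar R} := mu_copy.

End sigma_finite_packing.

Theorem theorem1 (R : realType) (d Q : nat) (Phi : 'Z_Q -> 'rV[R]_d) (alpha : R)
    (haar_Gamma :
       {measure set (closed_subgroup (range (step_function Phi))) -> \bar R}) :
  (1 < Q)%N ->
  centered (step_function Phi) ->
  is_haar haar_Gamma ->
  SBAD alpha Q \/ irrational alpha /\ prime Q ->
  let m := (@haar_circle R \x haar_Gamma)%E in
  let T := skew_product alpha (step_function Phi) in
  [/\ conservative m T, ergodic m T & measure_preserving m T].
Proof.
move=> Q_gt1 Phi_centered haar alphaQ m T.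
have [irr [c0 c0_gt0 good]] : irrational alpha /\ exists2 c0 : R, 0 < c0 &
    forall N, exists2 t, (N <= t)%N & good_time alpha Q t (c0 / t%:R).
  case: alphaQ => [sbad|[irr pQ]].
    by split; [exact: sbad.1|apply: good_times_SBAD => //; exact: sbad.1].
  by split => //; exact: good_times_prime.
pose nu := pack_sigma_finite (haar_sigma_finite haar).
have haar_nu : is_haar nu by exact: haar.
split.
- exact: (skew_product_conservative Q_gt1 haar_nu Phi_centered good).
- exact: (skew_product_ergodic Q_gt1 haar_nu Phi_centered irr c0_gt0 good).
- exact: (skew_product_measure_preserving _ Q_gt1 haar_nu).
Qed.
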